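(* Let $q\ge2$, $T=\mathbb T_q$ the homogeneous tree of degree $q+1$ with root $o$ and reference end $\varpi$, $\alpha\in(0,1)$, and $P$ the affine nearest-neighbour random walk with $p(x,y)=\alpha/q$ if $\mathrm{hor}(y)=\mathrm{hor}(x)+1$ and $p(x,y)=1-\alpha$ if $\mathrm{hor}(y)=\mathrm{hor}(x)-1$. Put $\rho=2\sqrt{\alpha(1-\alpha)}$ and $\lambda_0=\frac{q+1}{2\sqrt q}\rho$. Let $\lambda\in\mathbb C\setminus[-\rho,\rho]$ with $\lambda\ne\lambda_0$, and $\xi\in\partial T$. Let $\nu^\xi$ and $\tilde\nu^\xi$ be the (unique) strong distributions on $\partial T$ such that for all $x\in T$ $$\tilde K(x,\xi|\lambda)=\int_{\partial T}K(x,\cdot|\lambda)\,d\nu^\xi,\qquad K(x,\xi|\lambda)=\int_{\partial T}\tilde K(x,\cdot|\lambda)\,d\tilde\nu^\xi.$$ Then $\nu^\xi$ extends to a complex $\sigma$-additive Borel measure on $\partial T$, while $\tilde\nu^\xi$ does not. If in particular $\lambda>\rho$ is real, then $\nu^\xi$ is a Borel probability measure whose support is all of $\partial T$, so that $\tilde K(\cdot,\xi|\lambda)$ is not minimal in $\mathcal H_o(\lambda)$.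
   Context: Ends, $\partial T$, geodesics $\pi(x,y)$, cones $T_x$, arcs $\partial T_x$, predecessor $x^-$ and confluent $v\wedge w$ (w.r.t. $o$) as usual; $\partial T$ carries the topology generated by the arcs $\partial T_x$. $\mathrm{hor}(x,\xi)=d(x,x\wedge\xi)-d(o,x\wedge\xi)$, $\mathrm{hor}(x)=\mathrm{hor}(x,\varpi)$. Square roots: principal branch on $\mathbb C\setminus(-\infty,0]$. $F_-(\lambda)=\frac{\lambda}{2\alpha}(1-\sqrt{1-4\alpha(1-\alpha)/\lambda^2})$, $\tilde F_-(\lambda)=\frac{\lambda}{2\alpha}(1+\sqrt{1-4\alpha(1-\alpha)/\lambda^2})$, $F_+=\frac{\alpha}{(1-\alpha)q}F_-$, $\tilde F_+=\frac{\alpha}{(1-\alpha)q}\tilde F_-$. Edge weights $f(x,y)=F_\pm(\lambda)$, $\tilde f(x,y)=\tilde F_\pm(\lambda)$ for $x\sim y$ with $\mathrm{hor}(y)=\mathrm{hor}(x)\pm1$, extended by $1$ on the diagonal and multiplicatively along geodesics; $K(x,w|\lambda)=f(x,x\wedge w)/f(o,x\wedge w)$, $\tilde K(x,w|\lambda)=\tilde f(x,x\wedge w)/\tilde f(o,x\wedge w)$. A distribution is a complex finitely additive set function on the algebra of finite disjoint unions of sets $\partial T_x\setminus\bigcup_{y\in S}\partial T_y$ ($S$ finite, $y^-=x$), integrated against locally constant functions in the obvious way; strong means $\sum_{y:y^-=x}\nu(\partial T_y)$ converges absolutely for each $x$. ''Extends to a $\sigma$-additive Borel measure'' means there is a complex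 Borel measure on $\partial T$ agreeing with the distribution on that algebra. $\mathcal H_o(\lambda)=\{h:T\to(0,\infty)\mid h(o)=1,\ Ph=\lambda h\}$; $h$ is minimal if it is an extremal point of this convex set. *)

(* Defs.v *)
From HB Require Import structures.
From mathcomp Require Import all_boot all_order all_algebra.
From mathcomp Require Import reals.
From mathcomp.real_closed Require Export complex.
Set Implicit Arguments. Unset Strict Implicit. Unset Printing Implicit Defensive.
Import Order.TTheory GRing.Theory Num.Theory.
Local Open Scope ring_scope.
Local Open Scope complex_scope.

(* The homogeneous tree T_q of degree q+1, modelled as the Cayley graph of  *)
(* the free product of q+1 copies of Z/2: vertices are the reduced words    *)
(* (no two consecutive equal letters) over the alphabet 'I_q.+1, the root o *)
(* is the empty word, and x ~ y iff one is obtained from the other by       *)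
(* appending one letter.  Ends are infinite reduced words.                  *)
Section Tree.
Variable q : nat.
Definition word := seq 'I_q.+1.

Definition reduced (s : word) : bool := sorted (fun a b : 'I_q.+1 => a != b) s.

Record tend := TEnd { tend_f :> nat -> 'I_q.+1 ;
                      tend_P : forall n, tend_f n.+1 != tend_f n }.

Definition pre (w : tend) (n : nat) : word := mkseq w n.

(* longest common prefix = confluent v /\ w with respect to o *)
Fixpoint lcp (s t : word) : word :=
  match s, t with
  | a :: s', b :: t' => if a == b then a :: lcp s' t' else [::]
  | _, _ => [::]
  end.

Definition conf (x : word) (w : tend) : word := lcp x (pre w (size x)).

Definition arc (x : word) : tend -> Prop := fun w => pre w (size x) = x.

Definition is_child (x y : word) : Prop :=
  reduced y /\ exists a : 'I_q.+1, y = rcons x a.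

Definition parent (x : word) : word := take (size x).-1 x.

Definition basic (A : tend -> Prop) : Prop :=
  exists (x : word) (S : seq word), reduced x /\
    (forall y, y \in S -> is_child x y) /\
    A = (fun w => arc x w /\ ~ (exists y, y \in S /\ arc y w)).

Definition alg (A : tend -> Prop) : Prop :=
  exists Bs : seq (tend -> Prop),
    (forall i, (i < size Bs)%N -> basic (nth (fun _ => False) Bs i)) /\
    (forall i j, (i < j)%N -> (j < size Bs)%N -> forall w,
        ~ (nth (fun _ => False) Bs i w /\ nth (fun _ => False) Bs j w)) /\
    A = (fun w => exists i, (i < size Bs)%N /\ nth (fun _ => False) Bs i w).

(* topology on dT generated by the arcs (they form a base): U is open iff   *)
(* each of its points has an arc neighbourhood contained in U               *)
Definition isopen (U : tend -> Prop) : Prop :=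
  forall w, U w -> exists n, forall w', pre w' n = pre w n -> U w'.

Definition borel (A : tend -> Prop) : Prop :=
  forall S : (tend -> Prop) -> Prop,
    S (fun _ => False) ->
    (forall B, S B -> S (fun w => ~ B w)) ->
    (forall Bn : nat -> tend -> Prop, (forall n, S (Bn n)) ->
        S (fun w => exists n, Bn n w)) ->
    (forall U, isopen U -> S U) ->
    S A.

End Tree.

Section Analysis.
Variable R : realType.
Variable q : nat.
Local Notation C := R[i].
Local Notation word := (word q).
Local Notation tend := (tend q).

(* horocycle index hor(x, varpi) = d(x, x/\varpi) - d(o, x/\varpi) *)
Definition hor (varpi : tend) (x : word) : int :=
  (size x)%:Z - 2%:Z * (size (conf x varpi))%:Z.

(* principal square root on C \ (-oo,0] : sqrtc of mathcomp-real-closed *)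
Definition Fm (alpha : R) (lam : C) : C :=
  lam / (2%:R * alpha%:C) *
    (1 - sqrtc (1 - 4%:R * (alpha * (1 - alpha))%:C / lam ^+ 2)).
Definition Fmt (alpha : R) (lam : C) : C :=
  lam / (2%:R * alpha%:C) *
    (1 + sqrtc (1 - 4%:R * (alpha * (1 - alpha))%:C / lam ^+ 2)).
Definition Fp (alpha : R) (lam : C) : C :=
  (alpha / ((1 - alpha) * q%:R))%:C * Fm alpha lam.
Definition Fpt (alpha : R) (lam : C) : C :=
  (alpha / ((1 - alpha) * q%:R))%:C * Fmt alpha lam.

Definition edgew (varpi : tend) (Fplus Fminus : C) (u w : word) : C :=
  if hor varpi w == hor varpi u + 1 then Fplus else Fminus.

(* multiplicative extension along the geodesic x -> x/\y -> y *)
Definition fw (varpi : tend) (Fplus Fminus : C) (x y : word) : C :=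
  let c := lcp x y in
  (\prod_(size c <= k < size x) edgew varpi Fplus Fminus (take k.+1 x) (take k x)) *
  (\prod_(size c <= k < size y) edgew varpi Fplus Fminus (take k y) (take k.+1 y)).

Definition Kf (varpi : tend) (Fplus Fminus : C) (x : word) (w : tend) : C :=
  fw varpi Fplus Fminus x (conf x w) / fw varpi Fplus Fminus [::] (conf x w).

Definition K varpi alpha lam := Kf varpi (Fp alpha lam) (Fm alpha lam).
Definition Kt varpi alpha lam := Kf varpi (Fpt alpha lam) (Fmt alpha lam).

Definition distribution (nu : (tend -> Prop) -> C) : Prop :=
  forall A B, alg A -> alg B -> (forall w, ~ (A w /\ B w)) ->
    nu (fun w => A w \/ B w) = nu A + nu B.

(* integral of a locally constant phi against nu equals I: phi is constant *)
(* (value c v) on each arc dT_v, |v| = n, and I = sum_v c v * nu(dT_v)      *)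
Definition dint (nu : (tend -> Prop) -> C) (phi : tend -> C) (I : C) : Prop :=
  exists (n : nat) (c : word -> C),
    (forall v : word, reduced v -> size v = n -> forall w, arc v w -> phi w = c v) /\
    I = \sum_(t : n.-tuple 'I_q.+1 | reduced t) c t * nu (arc t).

Definition ccvg (s : nat -> C) (l : C) : Prop :=
  forall e : R, 0 < e -> exists N, forall n, (N <= n)%N -> `|s n - l| < e%:C.

Definition cmeasure (mu : (tend -> Prop) -> C) : Prop :=
  forall An : nat -> tend -> Prop, (forall n, borel (An n)) ->
    (forall n m, n <> m -> forall w, ~ (An n w /\ An m w)) ->
    ccvg (fun N => \sum_(k < N) mu (An k)) (mu (fun w => exists n, An n w)).

Definition extends_to (nu mu : (tend -> Prop) -> C) : Prop :=
  cmeasure mu /\ forall A, alg A -> mu A = nu A.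

Definition extends_sigma (nu : (tend -> Prop) -> C) : Prop :=
  exists mu, extends_to nu mu.

Definition ptrans (varpi : tend) (alpha : R) (x y : word) : C :=
  if hor varpi y == hor varpi x + 1 then (alpha / q%:R)%:C else (1 - alpha)%:C.

Definition Pop (varpi : tend) (alpha : R) (h : word -> C) (x : word) : C :=
  \sum_(a < q.+1 | reduced (rcons x a)) ptrans varpi alpha x (rcons x a) * h (rcons x a)
  + (if x is [::] then 0 else ptrans varpi alpha x (parent x) * h (parent x)).

(* H_o(lam); positivity 0 < h x in R[i] means h x is real and positive *)
Definition Ho (varpi : tend) (alpha : R) (lam : C) (h : word -> C) : Prop :=
  h [::] = 1 /\
  forall x, reduced x -> 0 < h x /\ Pop varpi alpha h x = lam * h x.

Definition minimal (varpi : tend) (alpha : R) (lam : C) (h : word -> C) : Prop :=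
  Ho varpi alpha lam h /\
  forall (h1 h2 : word -> C) (t : R),
    Ho varpi alpha lam h1 -> Ho varpi alpha lam h2 -> 0 < t < 1 ->
    (forall x, reduced x -> h x = t%:C * h1 x + (1 - t)%:C * h2 x) ->
    forall x, reduced x -> h1 x = h2 x.

End Analysis.

(* Main.v *)
From HB Require Import structures.
From mathcomp Require Import all_boot all_order all_algebra.
From mathcomp Require Import boolp classical_sets reals ereal topology normedtype.
From mathcomp Require Import sequences measure lebesgue_measure.
From mathcomp.real_closed Require Import complex.
From mathcomp Require Import ring lra zify.
Require Import Defs.
Set Implicit Arguments. Unset Strict Implicit. Unset Printing Implicit Defensive.
Import Order.TTheory GRing.Theory Num.Theory.
Local Open Scope ring_scope.
Local Open Scope complex_scope.

(* Since f(x,y) f(y,x) = (F_+ F_-)^d(x,y), the kernel is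
     K(x,w) = F_-^|x| kappa^|x /\ varpi| (kappa F_-^2)^(-|x /\ w|),
   kappa = alpha / ((1 - alpha) q), and similarly for the tilde kernel, so the
   reference end cancels from the integral equation.  Subtracting the equations
   at x and at its predecessor isolates the mass of the arc of x: with
   w = F_- / F~_- and j = |x /\ xi|, it is proportional to w^j q^(j - |x|) (1 - w)
   off the ray to xi and to w^|x| (1 - 1/q) on it; exchanging the two kernels
   replaces w by 1/w.  Off [-rho, rho] one has |w| < 1.  Hence nu is dominated on
   arcs by a multiple of the additive function belonging to |w|, so it is a
   combination of positive measures, each obtained as an image of Lebesgue
   measure, whereas the masses of the other distribution along the ray do not
   converge.  For real lambda > rho, non-minimality is witnessed by a harmonic
   function carried by one branch at the root: it is F_-^|x| off that branch, a
   combination of F_-^|x| and F~_-^|x| on it (times the kappa factor), and it is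
   dominated by a multiple of the tilde kernel. *)

(** * Ends and arcs *)

Lemma pre_size {q} (w : tend q) n : size (pre w n) = n.
Proof. exact: size_mkseq. Qed.

Lemma preS {q} (w : tend q) n : pre w n.+1 = rcons (pre w n) (w n).
Proof. by rewrite /pre mkseqS. Qed.

Lemma take_pre {q} (w : tend q) m n : (m <= n)%N -> take m (pre w n) = pre w m.
Proof.
move=> mn; rewrite /pre -map_take take_iota; congr (map _ (iota _ _)).
exact/minn_idPl.
Qed.

Lemma reduced_rcons {q} (x : word q) a b :
  reduced (rcons (rcons x b) a) = reduced (rcons x b) && (b != a).
Proof.
case: x => [|c x]; first by rewrite /reduced /= andbT.
by rewrite /reduced !rcons_cons /= rcons_path last_rcons.
Qed.

Lemma reduced_rconsW {q} (x : word q) a : reduced (rcons x a) -> reduced x.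
Proof. by case/lastP: x => // x b; rewrite reduced_rcons => /andP[]. Qed.

Lemma reduced_pre {q} (w : tend q) n : reduced (pre w n).
Proof.
elim: n => // n ih; rewrite preS; case: n ih => // n ih.
by move: ih; rewrite !preS reduced_rcons => ->; rewrite eq_sym tend_P.
Qed.

(** * Coding real numbers by ends *)

Lemma partial_sum_bracket {R : realType} {n} (f : 'I_n -> R) (r : R) :
  0 <= r < \sum_i f i ->
  exists i : 'I_n, \sum_(b < n | (b < i)%N) f b <= r < \sum_(b < n | (b <= i)%N) f b.
Proof.
move=> /andP[r0 rs].
have ex : exists k, r < \sum_(b < n | (b < k)%N) f b.
  by exists n; under eq_bigl => b do rewrite ltn_ord.
(* The least such [k] is positive because [r] is nonnegative; its predecessor is the index
   wanted. *)
have mk := ex_minnP ex; case: mk => -[|k].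
  by rewrite big_pred0 ?ltNge ?r0.
move=> rk mk; have kn : (k < n)%N.
  rewrite ltnNge; apply/negP => nk.
  suff /mk : r < \sum_(b < n | (b < k)%N) f b by rewrite ltnn.
  by under eq_bigl => b do rewrite (leq_trans (ltn_ord b) nk).
exists (Ordinal kn) => /=; apply/andP; split; last exact: rk.
by rewrite leNgt; apply/negP => /mk; rewrite ltnn.
Qed.

Section Intervals.
Context {R : realType} {q : nat} (p : word q -> R).
Hypothesis p_ge0 : forall x, 0 <= p x.
Hypothesis p_add : forall x, p x = \sum_a p (rcons x a).

(* The cells of the children of [x] partition the cell of [x] into consecutive
   half-open intervals of lengths [p], so that Lebesgue measure on the root cell
   is carried to the wanted measure by sending a real to the end coding it. *)
Definition offset (x : word q) (a : 'I_q.+1) : R := \sum_(b < q.+1 | (b < a)%N) p (rcons x b).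

Definition left_end (x : word q) : R :=
  \sum_(k < size x) offset (take k x) (nth ord0 x k).

Definition cell (x : word q) (r : R) : bool := left_end x <= r < left_end x + p x.

Lemma left_end_rcons x a : left_end (rcons x a) = left_end x + offset x a.
Proof.
rewrite /left_end size_rcons big_ord_recr /= -cats1 take_size_cat // nth_cat ltnn subnn /=.
congr (_ + _); apply: eq_bigr => k _.
by rewrite take_cat nth_cat ltn_ord.
Qed.

Lemma offset_next x a :
  offset x a + p (rcons x a) = \sum_(b < q.+1 | (b <= a)%N) p (rcons x b).
Proof.
rewrite (bigD1 a) //= addrC; congr (_ + _); apply: eq_bigl => b.
by rewrite ltn_neqAle andbC.
Qed.

Lemma cell_rcons x a r : cell (rcons x a) r -> cell x r.
Proof.
rewrite /cell left_end_rcons -addrA offset_next => /andP[l u].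
have o0 : 0 <= offset x a by exact: sumr_ge0.
apply/andP; split; first by lra.
apply: (lt_le_trans u); rewrite lerD2l p_add [leRHS](bigID (fun b : 'I_q.+1 => (b <= a)%N)) /=.
by rewrite lerDl sumr_ge0.
Qed.

Lemma cell_child x r : cell x r -> exists a, cell (rcons x a) r.
Proof.
move=> /andP[l u].
have [|a] := @partial_sum_bracket R q.+1 (fun a => p (rcons x a)) (r - left_end x).
  by rewrite -p_add; lra.
by exists a; rewrite /cell left_end_rcons -addrA offset_next /offset; lra.
Qed.

(** Cells are nested, so the prefixes agree by induction. Siblings are disjoint because the partial
    sum that closes the cell of [a] is at most the one that opens the cell of a later letter [b]. *)
Lemma cell_inj x y r : size x = size y -> cell x r -> cell y r -> x = y.
Proof.
elim/last_ind: x y => [|x a ih] y; first by move/esym/size0nil.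
case/lastP: y => [|y b]; first by rewrite size_rcons.
rewrite !size_rcons => -[sxy] cx cy.
have {ih} exy := ih _ sxy (cell_rcons cx) (cell_rcons cy); subst y.
congr rcons; move: cx cy; rewrite /cell !left_end_rcons -!addrA !offset_next.
wlog ab : a b / (a <= b)%N.
  by move=> wl cx cy; have [ab|/ltnW ab] := leqP a b; [|apply/esym]; exact: wl.
move=> /andP[_ ua] /andP[lb _]; apply/val_inj/eqP; rewrite eqn_leq ab leqNgt /=.
apply/negP => ltab; have := lt_le_trans (le_lt_trans lb ua).
suff /[swap] /[apply] : left_end x + \sum_(b0 < q.+1 | (b0 <= a)%N) p (rcons x b0) <=
   left_end x + offset x b by rewrite ltxx.
rewrite lerD2l /offset [leRHS](bigID (fun c : 'I_q.+1 => (c <= a)%N)) /=.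
rewrite (eq_bigl (fun i : 'I_q.+1 => (i < b)%N && (i <= a)%N)).
  by rewrite lerDl sumr_ge0.
by move=> i; case: (leqP i a) => [ia|]; rewrite ?andbF ?andbT //= (leq_ltn_trans ia ltab).
Qed.

Hypothesis p_red : forall x, ~~ reduced x -> p x = 0.

(** A word that is not reduced has weight zero, and a half-open interval of length zero is empty;
    this keeps the coding inside reduced words. *)
Lemma cell_reduced x r : cell x r -> reduced x.
Proof.
apply: contraPT => /p_red; rewrite /cell => ->; rewrite addr0.
by move=> /andP[/le_lt_trans h /h]; rewrite ltxx.
Qed.

Lemma cell_end r : cell [::] r -> exists w : tend q, forall n, cell (pre w n) r.
Proof.
move=> c0.
(* The default [ord0] is never taken: [cell_child] always supplies a letter. *)
pose f := fix f n := if n is n'.+1 then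
   rcons (f n') (odflt ord0 [pick a | cell (rcons (f n') a) r]) else [::].
have cf n : cell (f n) r.
  elim: n => //= n ih; case: pickP => //= no.
  by have [a] := cell_child ih; rewrite no.
pose g n := odflt ord0 [pick a | cell (rcons (f n) a) r].
have fS n : f n.+1 = rcons (f n) (g n) by [].
have gP n : g n.+1 != g n.
  have := cell_reduced (cf n.+2); rewrite 2!fS reduced_rcons => /andP[_].
  by rewrite eq_sym.
exists (TEnd gP) => n; suff -> : pre (TEnd gP) n = f n by [].
by elim: n => // n ih; rewrite preS ih fS.
Qed.

End Intervals.

(** * Borel sets and measures built from arc weights *)

Lemma arc_pre {q} (w : tend q) n w' : arc (pre w n) w' <-> pre w' n = pre w n.
Proof. by rewrite /arc pre_size. Qed.

Lemma isopen_arc {q} (x : word q) : isopen (arc x).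
Proof. by move=> w xw; exists (size x) => w' ww'; rewrite /arc ww'. Qed.

Lemma borel_open {q} (U : tend q -> Prop) : isopen U -> borel U.
Proof. by move=> oU S _ _ _; apply. Qed.

(** Words are countable, so an open set is a countable union of the arcs inside it; indexing by
    [pickle] codes gives the shape of union that occurs in [borel]. *)
Lemma open_bigcup_arc {q} (U : tend q -> Prop) : isopen U ->
  U = (fun w => exists n, exists2 x : word q,
         pickle_inv n = Some x & [/\ reduced x, arc x w & forall w', arc x w' -> U w']).
Proof.
move=> oU; apply/predeqP => w; split=> [Uw|[n [x _ [_ xw]]]]; last exact.
have [n hn] := oU w Uw; exists (pickle (pre w n)), (pre w n).
  exact: pickleK_inv.
by split; [exact: reduced_pre|exact/arc_pre|move=> w' /arc_pre; exact: hn].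
Qed.

(** The measure is the image of Lebesgue measure on the root cell under the coding map; [w0] fills
    in the values of that map outside the root cell. *)
Lemma word_measure {R : realType} {q} (w0 : tend q) (p : word q -> R) :
  (forall x, 0 <= p x) -> (forall x, p x = \sum_a p (rcons x a)) ->
  (forall x, ~~ reduced x -> p x = 0) ->
  exists m : (tend q -> Prop) -> R,
  [/\ forall A, 0 <= m A,
      forall x, reduced x -> m (arc x) = p x &
      forall An : nat -> tend q -> Prop, (forall n, borel (An n)) ->
        (forall i j, i <> j -> forall w, ~ (An i w /\ An j w)) ->
        forall e : R, 0 < e -> exists N, forall n, (N <= n)%N ->
          `|\sum_(k < n) m (An k) - m (fun w => exists k, An k w)| < e ].
Proof.
move=> p0 padd pred.
pose D : set R := [set r | cell p [::] r]%classic.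
have /choice[X XP] : forall r, exists w : tend q, D r -> forall n, cell p (pre w n) r.
  move=> r; have [/(cell_end padd pred)[w hw]|nD] := pselect (D r); first by exists w.
  by exists w0.
have arcX x : (D `&` X @^-1` (arc x) = [set r | cell p x r])%classic.
  apply/seteqP; split=> r /=; first by case=> /XP h; rewrite /arc => <-; exact: h.
  move=> cx; have Dr : D r.
    rewrite /D /=; elim/last_ind: x cx => // x a ih /(cell_rcons p0 padd); exact: ih.
  split=> //; apply: (cell_inj p0 padd _ (XP _ Dr _) cx).
  by rewrite pre_size.
have cellE x : ([set r | cell p x r] = `[left_end p x, left_end p x + p x[)%classic.
  by apply/predeqP => r; rewrite /mkset /= in_itv.
have mcell x : measurable ([set r | cell p x r]%classic : set R).
  by rewrite cellE; exact: measurable_itv.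
pose Y A : set R := (D `&` X @^-1` A)%classic.
have YU (F : nat -> tend q -> Prop) : Y (fun w => exists n, F n w) = (\bigcup_n Y (F n))%classic.
  apply/seteqP; split => r /= [] => [Dr [n Bnr]|n _ [Dr Bnr]]; first by exists n.
  by split=> //; exists n.
have mY A : borel A -> measurable (Y A).
  (* [borel] quantifies over all families with the closure properties of a sigma-algebra that
     contain the open sets; it is applied to the sets with measurable preimage. *)
  move=> bA; apply: (bA (fun A => measurable (Y A))); rewrite /Y.
  - have -> : (D `&` X @^-1` (fun=> False) = set0)%classic.
      by apply/seteqP; split => r // [].
    exact: measurable0.
  - move=> B mB.
    have -> : (D `&` X @^-1` (fun w => ~ B w) = D `\` (D `&` X @^-1` B))%classic.
      by apply/seteqP; split => r /= [Dr nB]; split=> //; [case|move=> XB; apply: nB].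
    by apply: measurableD => //; exact: mcell.
  - move=> Bn mB.
    by rewrite -/(Y _) YU; exact: bigcupT_measurable.
  - move=> U oU; rewrite (open_bigcup_arc oU).
    rewrite -/(Y _) YU; apply: bigcupT_measurable => n; rewrite /Y; case en : (pickle_inv n) => [x|]; last first.
      by rewrite [X in measurable X](_ : _ = set0)%classic //; apply/seteqP; split=> r // [_ []].
    (* A code contributes its arc when that arc lies in [U], and nothing otherwise. *)
    have [[rx xU]|nx] := pselect (reduced x /\ forall w', arc x w' -> U w').
      rewrite [X in measurable X](_ : _ = D `&` X @^-1` (arc x))%classic ?arcX //.
      rewrite -arcX; apply/seteqP; split=> r /= [Dr]; first by move=> [y [<-] [_ ay _]]; split.
      by move=> ax; split => //; exists x.
    rewrite [X in measurable X](_ : _ = set0)%classic //; apply/seteqP; split=> r //.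
    by move=> [_ [y [<-] [? _ ?]]]; apply: nx.
pose mu := @lebesgue_measure R.
have muD : mu D = (p [::])%:E.
  rewrite /D cellE /mu lebesgue_measure_itv /= lte_fin ltrDl -EFinB.
  have [|] := ltP 0 (p [::]); first by rewrite addrAC subrr add0r.
  by move=> h; congr EFin; apply/eqP; rewrite eq_le h p0.
have fY A : borel A -> mu (Y A) \is a fin_num.
  move=> bA; rewrite ge0_fin_numE //; apply: (@le_lt_trans _ _ (mu D)); last by rewrite muD ltry.
  by apply: le_measure; rewrite ?inE //; [exact: mY|exact: mcell|move=> r []].
exists (fun A => fine (mu (Y A))); split=> [A|x rx|An bA dA e e0].
- exact: fine_ge0.
- rewrite /Y arcX cellE /mu lebesgue_measure_itv /= lte_fin ltrDl -EFinB.
  have [|] := ltP 0 (p x); first by rewrite /= addrAC subrr add0r.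
  by move=> h; apply/esym/eqP; rewrite /= eq_le h p0.
- have bU : borel (fun w => exists k, An k w).
    by move=> S S0 SC SU SO; apply: (SU) => n; exact: (bA n).
  have tY : trivIset setT (fun k => Y (An k)).
    apply/trivIsetP => i j _ _ /eqP ij; apply/seteqP; split=> r //= [[_ ai] [_ aj]].
    exact: (dA i j ij (X r)).
  have := measure_sigma_additive (mu := mu) (fun k => mY _ (bA k)) tY.
  rewrite -YU => h.
  have /fine_cvg h' : ((\sum_(0 <= i < n) mu (Y (An i))) @[n --> \oo] -->
      (fine (mu (Y (fun w => exists k, An k w))))%:E)%E%classic.
    by rewrite fineK // fY.
  move/cvgrPdist_lt : h' => /(_ e e0) [N _ hN]; exists N => n Nn.
  have := hN n Nn; rewrite /= distrC big_mkord; congr (`|_ - _| < e).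
  by rewrite sum_fine // => i _; apply: fY.
Qed.

(** * Confluents and distributions *)

Lemma lcp_take {q} (x v : word q) : lcp x (take (size x) v) = lcp x v.
Proof. by elim: x v => [|a x ih] [|b v] //=; rewrite ih. Qed.

Lemma size_lcp_rcons {q} (x v : word q) a :
  size (lcp (rcons x a) v) =
  if take (size x).+1 v == rcons x a then (size x).+1 else size (lcp x v).
Proof.
elim: x v => [|c x ih] [|b v] //=.
  by rewrite take0 eqseq_cons eqxx andbT eq_sym; case: eqP.
rewrite eqseq_cons [b == c]eq_sym; case: (c =P b) => //= _.
by rewrite ih; case: ifP.
Qed.

Lemma lcp_prefix {q} (x v : word q) : lcp x v = take (size (lcp x v)) x.
Proof.
by elim: x v => [|a x ih] [|b v] //=; case: eqP => //= _; congr cons.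
Qed.

Lemma lcp_self {q} (x v : word q) : lcp x (lcp x v) = lcp x v.
Proof. by elim: x v => [|a x ih] [|b v] //=; case: eqP => //=; rewrite eqxx ih. Qed.

Lemma size_conf_le {q} (w : tend q) (x : word q) : (size (conf x w) <= size x)%N.
Proof. by rewrite /conf lcp_prefix size_take; case: ltnP => // /ltnW. Qed.

Lemma lcp_pre {q} (w : tend q) (x : word q) n :
  (size x <= n)%N -> lcp x (pre w n) = conf x w.
Proof. by move=> xn; rewrite -lcp_take take_pre. Qed.

Lemma size_conf_rcons {q} (w : tend q) (x : word q) a :
  size (conf (rcons x a) w) =
  if pre w (size x).+1 == rcons x a then (size x).+1 else size (conf x w).
Proof.
rewrite -(lcp_pre w (leqnSn (size x))) /conf size_rcons size_lcp_rcons.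
by rewrite take_oversize // pre_size.
Qed.

Lemma size_conf_pre {q} (w : tend q) n : size (conf (pre w n) w) = n.
Proof.
elim: n => // n ih; by rewrite preS size_conf_rcons pre_size preS eqxx.
Qed.

Lemma conf_eq_size {q} (w : tend q) (x : word q) :
  (size (conf x w) == size x) = (pre w (size x) == x).
Proof.
apply/eqP/eqP => [|<-]; last by rewrite size_conf_pre pre_size.
case/lastP: x => [|x a] //; rewrite size_conf_rcons size_rcons.
by case: eqP => // _ h; have := size_conf_le w x; rewrite h ltnn.
Qed.

(** After [x] the end alternates between [b] and the last letter [l] of [x], beginning with [b];
    positivity of [q] provides a letter different from [l]. *)
Lemma arc_nonempty {q} (x : word q) : (0 < q)%N -> reduced x -> exists w, arc x w.
Proof.
move=> q0 rx; pose l := last ord0 x.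
have [b bl] : exists b : 'I_q.+1, b != l.
  have [->|] := eqVneq l ord0; last by exists ord0; rewrite eq_sym.
  by exists (lift ord0 (Ordinal q0)).
pose f n := if (n < size x)%N then nth ord0 x n else if odd (n - size x) then l else b.
have fP n : f n.+1 != f n.
  rewrite /f; case: (ltnP n.+1 (size x)) => [n1x|].
    by rewrite (ltnW n1x) eq_sym; move/sortedP: rx => /(_ ord0); exact.
  rewrite leq_eqVlt => /orP[/eqP xn|].
    by rewrite xn ltnSn subnn /= (_ : nth _ _ _ = l) // /l (last_nth ord0) xn.
  rewrite ltnS => xn; rewrite ltnNge xn /= subSn //=.
  by case: (odd _) => //=; rewrite eq_sym.
exists (TEnd fP); rewrite /arc /pre; apply: (@eq_from_nth _ ord0); rewrite size_mkseq // => i ix.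
by rewrite nth_mkseq //= /f ix.
Qed.

Lemma alg_basic {q} (A : tend q -> Prop) : basic A -> alg A.
Proof.
move=> bA; exists [:: A]; split=> [[|i] //|]; split=> [i [|j] //|].
by apply/predeqP => w; split=> [Aw|[[|i] [] //]]; exists 0%N.
Qed.

Lemma alg0 {q} : alg (fun _ : tend q => False).
Proof.
exists [::]; split=> //; split=> //.
by apply/predeqP => w; split=> // -[i []].
Qed.

Lemma alg_arc {q} (x : word q) : reduced x -> alg (arc x).
Proof.
move=> rx; apply: alg_basic; exists x, [::]; split=> //; split=> //.
by apply/predeqP => w; split=> [?|[]//]; split=> // -[y []].
Qed.

Lemma algU {q} (A B : tend q -> Prop) : alg A -> alg B ->
  (forall w, ~ (A w /\ B w)) -> alg (fun w => A w \/ B w).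
Proof.
move=> [As [bA [dA eA]]] [Bs [bB [dB eB]]] dAB.
exists (As ++ Bs); split=> [i|]; last split=> [i j|].
- rewrite size_cat nth_cat; case: (ltnP i (size As)) => [ia _|ai iab]; first exact: bA.
  by apply: bB; lia.
- move=> ij; rewrite size_cat !nth_cat => jab w;
  case: (ltnP i (size As)) => ia; case: (ltnP j (size As)) => ja.
  + exact: dA.
  + move=> [iw jw]; apply: (dAB w); rewrite eA eB; split; first by exists i.
    by exists (j - size As)%N; split=> //; lia.
  + by lia.
  + by apply: dB; lia.
apply/predeqP => w; rewrite eA eB; split=> [[[i [si iw]]|[i [si iw]]]|[i []]].
- by exists i; rewrite size_cat nth_cat si; split=> //; lia.
- exists (size As + i)%N; rewrite size_cat nth_cat (ltnNge (_ + _) (size As)) leq_addr /= addKn.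
  by split=> //; lia.
rewrite size_cat nth_cat; case: (ltnP i (size As)) => [ia _ iw|ai iab iw]; [left; exists i|right].
  by [].
by exists (i - size As)%N; split=> //; lia.
Qed.

Lemma arc_disjoint {q} (x y : word q) w : size x = size y -> arc x w -> arc y w -> x = y.
Proof. by rewrite /arc => sxy ax ay; rewrite -ax sxy. Qed.

Section Distribution.
Context {R : realType} {q : nat}.
Implicit Types nu : (tend q -> Prop) -> R[i].

Lemma distribution0 nu : distribution nu -> nu (fun _ => False) = 0.
Proof.
move=> dn; have := dn _ _ alg0 alg0; rewrite (_ : (fun _ => _ \/ _) = (fun=> False)); last first.
  by apply/predeqP => w; split=> // -[].
by move=> /(_ (fun _ h => h.1)) e; apply: (addrI (nu (fun=> False))); rewrite addr0.
Qed.

(** Distinct words of equal length have disjoint arcs. Membership in [alg] travels through the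
    induction because additivity is granted only inside the algebra. *)
Lemma distribution_arcs nu (s : seq (word q)) n : distribution nu ->
  uniq s -> (forall y, y \in s -> reduced y /\ size y = n) ->
  alg (fun w => exists y, y \in s /\ arc y w) /\
  nu (fun w => exists y, y \in s /\ arc y w) = \sum_(y <- s) nu (arc y).
Proof.
move=> dn; elim: s => [_ _|x s ih /= /andP[xs us] sP].
  rewrite (_ : (fun _ => _) = (fun=> False)); last by apply/predeqP => w; split=> // -[y []].
  by rewrite big_nil distribution0 //; split=> //; exact: alg0.
have [|aS eS] := ih us; first by move=> y ys; apply: sP; rewrite inE ys orbT.
have [rx sx] := sP x (mem_head _ _).
have dxs w : ~ (arc x w /\ exists y, y \in s /\ arc y w).
  move=> [xw [y [ys yw]]]; have [_ sy] := sP y (mem_behead (s := x :: s) ys).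
  by move: xs; rewrite (arc_disjoint _ xw yw) ?sx ?sy // ys.
have -> : (fun w => exists y, y \in x :: s /\ arc y w) =
    (fun w => arc x w \/ exists y, y \in s /\ arc y w).
  apply/predeqP => w; split=> [[y []]|[xw|[y [ys yw]]]].
  - by rewrite inE => /orP[/eqP ->|ys yw]; [left|right; exists y].
  - by exists x; rewrite mem_head.
  - by exists y; rewrite inE ys orbT.
split; first by apply: algU => //; exact: alg_arc.
by rewrite big_cons -eS; apply: dn => //; exact: alg_arc.
Qed.

Lemma distribution_children nu (x : word q) : distribution nu -> reduced x ->
  nu (arc x) = \sum_(a | reduced (rcons x a)) nu (arc (rcons x a)).
Proof.
move=> dn rx.
pose s := [seq rcons x a | a <- enum [pred a | reduced (rcons x a)]].
have [||_] := @distribution_arcs nu s (size x).+1 dn.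
- by rewrite map_inj_uniq ?enum_uniq // => a b /rcons_inj[].
- by move=> y /mapP[a]; rewrite mem_enum => ra ->; rewrite size_rcons.
rewrite big_map big_enum /= => <-; congr nu; apply/predeqP => w; split.
  move=> xw; exists (rcons x (w (size x))); split.
    apply: map_f; rewrite mem_enum inE.
    by have := reduced_pre w (size x).+1; rewrite preS xw.
  by rewrite /arc size_rcons preS xw.
move=> [y [/mapP[a _ ->]]]; rewrite /arc size_rcons preS => /rcons_inj[].
by [].
Qed.

(** The basic set and the removed arcs partition the arc of [x]; [undup] prevents a child listed
    twice in [S] from being counted twice. *)
Lemma distribution_basic nu (x : word q) (S : seq (word q)) : distribution nu -> reduced x ->
  (forall y, y \in S -> is_child x y) ->
  nu (fun w => arc x w /\ ~ (exists y, y \in S /\ arc y w)) =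
  nu (arc x) - \sum_(y <- undup S) nu (arc y).
Proof.
move=> dn rx cS.
have [||aS <-] := @distribution_arcs nu (undup S) (size x).+1 dn.
- exact: undup_uniq.
- by move=> y; rewrite mem_undup => /cS[ry [a ea]]; split=> //; rewrite ea size_rcons.
apply/eqP; rewrite eq_sym subr_eq; apply/eqP.
rewrite -dn //; last 2 first.
- by apply: alg_basic; exists x, S.
- by move=> w [[_ h] [y []]]; rewrite mem_undup => *; apply: h; exists y.
congr nu; apply/predeqP => w; split=> [xw|].
  have [h|h] := pselect (exists y, y \in S /\ arc y w); last by left.
  by right; have [y [yS yw]] := h; exists y; rewrite mem_undup.
move=> [[]//|[y []]]; rewrite mem_undup => /cS[_ [a ->]].
by rewrite /arc size_rcons preS => /rcons_inj[].
Qed.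

(** A set of the algebra is a disjoint union of basic sets, and the mass of a basic set is an arc
    mass minus masses of child arcs. *)
Lemma distribution_eq_arc nu nu' : distribution nu -> distribution nu' ->
  (forall x, reduced x -> nu (arc x) = nu' (arc x)) ->
  forall A, alg A -> nu A = nu' A.
Proof.
move=> dn dn' eq_arc A [Bs [bB [dB ->]]].
suff [] : alg (fun w => exists i, (i < size Bs)%N /\ nth (fun=> False) Bs i w) /\
  nu (fun w => exists i, (i < size Bs)%N /\ nth (fun=> False) Bs i w) =
  nu' (fun w => exists i, (i < size Bs)%N /\ nth (fun=> False) Bs i w) by [].
elim: Bs bB dB => [_ _|B Bs ih bB dB].
  rewrite (_ : (fun _ => _) = (fun=> False)); last by apply/predeqP => w; split=> // -[y []].
  by rewrite !distribution0 //; split=> //; exact: alg0.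
have [|| aS eS] := ih; first by move=> i si; exact: (bB i.+1).
  by move=> i j ij sj w; exact: (dB i.+1 j.+1).
have -> : (fun w => exists i, (i < size (B :: Bs))%N /\ nth (fun=> False) (B :: Bs) i w) =
    (fun w => B w \/ exists i, (i < size Bs)%N /\ nth (fun=> False) Bs i w).
  apply/predeqP => w; split=> [[[|i] [si iw]]|[Bw|[i [si iw]]]].
  - by left.
  - by right; exists i.
  - by exists 0%N.
  - by exists i.+1.
have bB0 : basic B by exact: (bB 0%N).
have dBs w : ~ (B w /\ exists i, (i < size Bs)%N /\ nth (fun=> False) Bs i w).
  by move=> [Bw [i [si iw]]]; apply: (dB 0%N i.+1 _ _ w).
have aB := alg_basic bB0.
split; first exact: algU.
rewrite dn // dn' // eS; congr (_ + _).
have [x [S [rx [cS ->]]]] := bB0.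
rewrite !distribution_basic // eq_arc //; congr (_ - _).
apply: eq_big_seq => y; rewrite mem_undup => /cS[ry _]; exact: eq_arc.
Qed.

End Distribution.

(** * The mass of an arc *)

(** For the reference end these are the two directions of the horocycle index: it rises from [x] to
    its child in the first case and falls in the second, where the child lies on the ray. *)
Lemma size_conf_rcons_cases {q} (w : tend q) (x : word q) a :
  size (conf (rcons x a) w) = size (conf x w) \/
  size (conf (rcons x a) w) = (size (conf x w)).+1 /\ size (conf x w) = size x.
Proof.
rewrite size_conf_rcons; case: eqP => [e|_]; last by left.
have /eqP : size (conf x w) == size x.
  by rewrite conf_eq_size; move: e; rewrite preS => /rcons_inj[->].
by move=> e'; right; rewrite e'.
Qed.

Section Kernel.
Context {R : realType} {q : nat} (varpi : tend q).
Local Notation C := R[i].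
Implicit Types (Fu Fd kap a : C) (x : word q).

Lemma edgew_down Fu Fd x c :
  edgew varpi Fu Fd (rcons x c) x =
  if size (conf (rcons x c) varpi) == size (conf x varpi) then Fd else Fu.
Proof.
rewrite /edgew /hor size_rcons; case: (size_conf_rcons_cases varpi x c) => [->|[-> _]].
  by rewrite eqxx ifN //; lia.
by rewrite ifT 1?ifN //; lia.
Qed.

Lemma edgew_up Fu Fd x c :
  edgew varpi Fu Fd x (rcons x c) =
  if size (conf (rcons x c) varpi) == size (conf x varpi) then Fu else Fd.
Proof.
rewrite /edgew /hor size_rcons; case: (size_conf_rcons_cases varpi x c) => [->|[-> _]].
  by rewrite eqxx ifT //; lia.
by rewrite !ifN //; lia.
Qed.

(** A step towards the root costs [a], with an extra [kap] exactly on the ray to [varpi], where the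
    step raises the horocycle index. *)
Lemma prod_edgew_down kap a x n : (n <= size x)%N ->
  \prod_(0 <= k < n) edgew varpi (kap * a) a (take k.+1 x) (take k x) =
  a ^+ n * kap ^+ size (conf (take n x) varpi).
Proof.
elim: n => [|n ih] nx; first by rewrite big_nil take0 mul1r.
rewrite big_nat_recr //= ih ?(ltnW nx) // (take_nth ord0) // edgew_down.
case: (size_conf_rcons_cases varpi (take n x) (nth ord0 x n)) => [->|[-> _]].
  by rewrite eqxx exprS; ring.
by rewrite ifN ?exprS; [ring|lia].
Qed.

(** With v the confluent, multiplicativity gives f(x,v) = f(x,o) / f(v,o), while f(v,o) f(o,v) =
    (kap a^2)^|v|; hence K = f(x,o) / (kap a^2)^|v|. *)
Lemma KfE kap a x w : kap != 0 -> a != 0 ->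
  Kf varpi (kap * a) a x w =
  a ^+ size x * kap ^+ size (conf x varpi) / (kap * a ^+ 2) ^+ size (conf x w).
Proof.
move=> kap0 a0; rewrite /Kf /fw /=; set v := conf x w; set k0 := size v.
have vE : v = take k0 x by rewrite /k0 /v /conf -lcp_prefix.
have k0x : (k0 <= size x)%N by exact: size_conf_le.
rewrite [lcp x v]lcp_self -/v -/k0 (big_geq (leqnn k0)) (big_geq (leqnn 0)) mulr1 mul1r.
have down := prod_edgew_down kap a (leqnn (size x)).
rewrite take_size (big_cat_nat (leq0n _) k0x) //= in down.
(* Each edge is crossed in both directions, once with weight [a] and once with [kap * a]. *)
have up : \prod_(0 <= k < k0) edgew varpi (kap * a) a (take k v) (take k.+1 v) *
    \prod_(0 <= k < k0) edgew varpi (kap * a) a (take k.+1 x) (take k x) = (kap * a ^+ 2) ^+ k0.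
  rewrite -big_split /= -[X in _ = _ ^+ X]subn0 -prodr_const_nat.
  apply: eq_big_nat => k /andP[_ kk0]; rewrite vE !take_takel ?(ltnW kk0) //.
  rewrite (take_nth ord0) ?(leq_trans kk0) // edgew_down edgew_up.
  by case: ifP => _; ring.
have t0 : (kap * a ^+ 2) ^+ k0 != 0 by rewrite expf_neq0 // mulf_neq0 // expf_neq0.
move: t0; rewrite -down -up mulf_eq0 negb_or => /andP[u0 d0].
by field; rewrite u0 d0.
Qed.

End Kernel.

Section Levels.
Context {R : realType} {q : nat}.
Local Notation C := R[i].
Implicit Types (nu : (tend q -> Prop) -> C) (g : word q -> C).

Lemma big_tuple_rcons n (F : word q -> C) :
  \sum_(t : n.+1.-tuple 'I_q.+1 | reduced t) F t =
  \sum_(t : n.-tuple 'I_q.+1 | reduced t) \sum_(a | reduced (rcons t a)) F (rcons t a).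
Proof.
pose h (u : n.-tuple 'I_q.+1 * 'I_q.+1) : n.+1.-tuple 'I_q.+1 := [tuple of rcons u.1 u.2].
have h_bij : bijective h.
  apply: inj_card_bij; last by rewrite card_prod !card_tuple card_ord expnSr.
  by move=> [t a] [t' a'] /(congr1 val)/= /rcons_inj[/val_inj -> ->].
rewrite (reindex h) /=; last exact: onW_bij.
rewrite (pair_big_dep (fun t : n.-tuple 'I_q.+1 => reduced t)
  (fun (t : n.-tuple 'I_q.+1) a => reduced (rcons t a))) /=; apply: eq_bigl => u.
by apply/idP/andP => [r|[]//]; split=> //; exact: reduced_rconsW r.
Qed.

Lemma level_sum_refine nu g n M : distribution nu -> (n <= M)%N ->
  \sum_(t : n.-tuple 'I_q.+1 | reduced t) g t * nu (arc t) =
  \sum_(t : M.-tuple 'I_q.+1 | reduced t) g (take n t) * nu (arc t).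
Proof.
move=> dn nM; rewrite -(subnK nM); elim: (M - n)%N => [|k ih].
  by apply: eq_bigr => t _; rewrite take_oversize // size_tuple.
rewrite ih addSn (big_tuple_rcons _ (fun x => g (take n x) * nu (arc x))) /=.
apply: eq_bigr => t rt; rewrite distribution_children // mulr_sumr.
by apply: eq_bigr => a _; rewrite -cats1 takel_cat // size_tuple leq_addl.
Qed.

(** [dint] leaves level and coefficients open. Both representations are refined to level [N + n],
    where their coefficients agree because the arc of a reduced word contains an end. *)
Lemma dint_level nu phi I N g : (0 < q)%N -> distribution nu -> dint nu phi I ->
  (forall w, phi w = g (pre w N)) ->
  I = \sum_(t : N.-tuple 'I_q.+1 | reduced t) g t * nu (arc t).
Proof.
move=> q0 dn [n [c [cP ->]]] gP.
rewrite (level_sum_refine c dn (leq_addr N n)).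
rewrite (level_sum_refine g dn (leq_addl n N)).
apply: eq_bigr => t rt; congr (_ * _).
have [w wt] := arc_nonempty q0 rt; rewrite /arc size_tuple in wt.
rewrite -wt !take_pre ?leq_addl ?leq_addr // -gP; apply/esym/cP; rewrite ?pre_size //.
  exact: reduced_pre.
by rewrite /arc pre_size.
Qed.

End Levels.

(* With w = F_-/F~_-, this is (1 - w/q) times the mass of the arc of [x]; with
   w = F~_-/F_-, that for the exchanged kernels. *)
Definition ray_mass {F : fieldType} {q} (xi : tend q) (w : F) (x : word q) : F :=
  if pre xi (size x) == x then
    (if x is [::] then 1 - w / q%:R else w ^+ size x * (1 - q%:R^-1))
  else (w * q%:R) ^+ size (conf x xi) / q%:R ^+ size x * (1 - w).

Section ArcMass.
Context {R : realType} {q : nat} (varpi xi : tend q).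
Local Notation C := R[i].
Variables (nu : (tend q -> Prop) -> C) (kap a b : C).
Hypotheses (q0 : (0 < q)%N) (kap0 : kap != 0) (a0 : a != 0) (b0 : b != 0).
Hypothesis dn : distribution nu.
Hypothesis nuP : forall x, reduced x ->
  dint nu (Kf varpi (kap * a) a x) (Kf varpi (kap * b) b x xi).

(* The dependence on the reference end cancels from both sides of the integral
   equation, leaving an isotropic one. *)
Lemma isotropic_equation (x : word q) n : reduced x -> (size x <= n)%N ->
  (b / a) ^+ size x / (kap * b ^+ 2) ^+ size (conf x xi) =
  \sum_(t : n.-tuple 'I_q.+1 | reduced t) (kap * a ^+ 2) ^- size (lcp x t) * nu (arc t).
Proof.
move=> rx xn.
pose g v := a ^+ size x * kap ^+ size (conf x varpi) / (kap * a ^+ 2) ^+ size (lcp x v).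
have e : Kf varpi (kap * b) b x xi = \sum_(t : n.-tuple 'I_q.+1 | reduced t) g t * nu (arc t).
  by apply: (dint_level q0 dn (nuP rx)) => w; rewrite KfE // /g lcp_pre.
have m0 : a ^+ size x * kap ^+ size (conf x varpi) != 0 by rewrite mulf_neq0 // expf_neq0.
apply: (mulfI m0); rewrite mulr_sumr; move: e; rewrite KfE // => e.
transitivity (b ^+ size x * kap ^+ size (conf x varpi) / (kap * b ^+ 2) ^+ size (conf x xi)).
  rewrite expr_div_n; have : a ^+ size x != 0 by rewrite expf_neq0.
  have : (kap * b ^+ 2) ^+ size (conf x xi) != 0 by rewrite !(expf_neq0, mulf_neq0).
  by move=> ? ?; field; apply/andP.
by rewrite e; apply: eq_bigr => t _; rewrite /g -[LHS]mulrA.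
Qed.


Hypothesis kabq : kap * a * b * q%:R = 1.

Lemma total_mass : nu (fun _ => True) = 1.
Proof.
have := @isotropic_equation [::] 0 isT (leqnn _).
rewrite divr1 expr0 (big_pred1 [tuple]) => [|t]; last by rewrite (tuple0 t); apply/esym/eqP.
rewrite /= expr0 invr1 mul1r => ->; congr nu.
by apply/predeqP => w; split.
Qed.

(** Keeping the factor on the left makes the formula usable for both orders of the kernels, without
    deciding whether the factor vanishes. *)
Lemma arc_mass (x : word q) : reduced x ->
  (1 - a / b / q%:R) * nu (arc x) = ray_mass xi (a / b) x.
Proof.
have qC : q%:R != 0 :> C by rewrite pnatr_eq0 -lt0n.
have kE : kap = (a * b * q%:R)^-1.
  have abq0 : a * b * q%:R != 0 by rewrite !mulf_neq0.
  by apply: (mulIf abq0); rewrite mulVf // !mulrA.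
case/lastP: x => [_|x c rx].
  rewrite /ray_mass /= (_ : arc [::] = (fun _ => True)) ?total_mass ?mulr1 //.
  by apply/predeqP => w; split.
have rx' := reduced_rconsW rx.
have := @isotropic_equation _ (size (rcons x c)) rx (leqnn _).
have := @isotropic_equation _ (size (rcons x c)) rx' (_ : _ <= _)%N.
rewrite size_rcons leqnSn => /(_ isT) e1 e2.
have tx : size (rcons x c) == (size x).+1 by rewrite size_rcons.
pose t := kap * a ^+ 2.
have t0 : t != 0 by rewrite !mulf_neq0.
(* At level |x| + 1 the confluents with [rcons x c] and with [x] differ only for the word
   [rcons x c] itself, so a single term survives. *)
have : (b / a) ^+ (size x).+1 / (kap * b ^+ 2) ^+ size (conf (rcons x c) xi)
   - (b / a) ^+ size x / (kap * b ^+ 2) ^+ size (conf x xi) =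
   (t ^- (size x).+1 - t ^- size x) * nu (arc (rcons x c)).
  rewrite e1 e2 -sumrB (bigD1 (Tuple tx)) //= big1 => [|s /andP[_ sx]].
    have -> : lcp (rcons x c) (rcons x c) = rcons x c.
      by rewrite lcp_prefix take_oversize // size_lcp_rcons; case: eqP => // -[]; rewrite take_oversize ?size_rcons.
    have -> : lcp x (rcons x c) = x.
      by rewrite -lcp_take -cats1 take_size_cat //; elim: (x) => //= d y ->; rewrite eqxx.
    by rewrite size_rcons addr0 mulrBl.
  rewrite size_lcp_rcons take_oversize ?size_tuple // ifN ?subrr //.
have w0 : a / b != 0 by rewrite mulf_neq0 ?invr_eq0.
(* By [kabq] only the ratio w = a / b remains: kap a^2 = w / q and kap b^2 = 1 / (w q). *)
have tE : t = a / b / q%:R by rewrite /t kE; field; rewrite a0 b0 qC.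
have tE' : kap * b ^+ 2 = (a / b * q%:R)^-1 by rewrite kE; field; rewrite a0 b0 qC.
rewrite tE' -[b / a]invrK invf_div -/t tE.
move: (a / b) w0 => w w0.
set j := size (conf x xi); set j' := size (conf (rcons x c) xi); set n := size x => e.
apply: (mulfI (_ : (w / q%:R) ^- n.+1 != 0)); first by rewrite invr_eq0 expf_neq0 // mulf_neq0 ?invr_eq0.
have -> : (w / q%:R) ^- n.+1 * ((1 - w / q%:R) * nu (arc (rcons x c))) =
   ((w / q%:R) ^- n.+1 - (w / q%:R) ^- n) * nu (arc (rcons x c)).
  have := expf_neq0 n w0; have := expf_neq0 n qC.
  by rewrite !expr_div_n !exprS; move=> ? ?; field; apply/and4P.
rewrite -e /ray_mass -conf_eq_size -/j' size_rcons -/n.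
have jn : (j <= n)%N by exact: size_conf_le.
have wn := expf_neq0 n w0; have qn := expf_neq0 n qC; have qj := expf_neq0 j qC.
have wj := expf_neq0 j w0.
(* Either the child is off the ray to [xi] and the confluent is unchanged, or it is on the ray and
   the confluent grows by one. *)
have := size_conf_rcons_cases xi x c; rewrite -/j -/j' => -[-> | [-> ->]].
  rewrite ifN; last by rewrite neq_ltn ltnS jn.
  by rewrite !expr_div_n !exprVn !invrK !exprMn !exprS; field; apply/and4P.
rewrite -/n eqxx headI /=.
by rewrite !expr_div_n !exprVn !invrK !exprMn !exprS; field; apply/and4P.
Qed.


End ArcMass.

(** * Complex measures *)

(** Whether an end lies in a basic set is decided by its first |x| + 1 letters, so the sets of the
    algebra are open. *)
Lemma alg_borel {q} (A : tend q -> Prop) : alg A -> borel A.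
Proof.
move=> [Bs [bB [_ ->]]]; apply: borel_open => w [i [si iw]].
have [x [S [_ [cS e]]]] := bB i si; rewrite e in iw; have [xw nS] := iw.
exists (size x).+1 => w' ww'; exists i; split=> //; rewrite e; split.
  by rewrite /arc -(take_pre w' (leqnSn _)) ww' take_pre.
move=> [y [yS yw']]; apply: nS; exists y; split=> //.
by move: yw'; have [_ [a ->]] := cS y yS; rewrite /arc size_rcons ww'.
Qed.

Section ComplexMeasure.
Context {R : realType} {q : nat}.
Local Notation C := R[i].
Implicit Types (mu nu : (tend q -> Prop) -> C).

Lemma ccvg_cst_eq (s : nat -> C) l c N : ccvg s l -> (forall n, (N <= n)%N -> s n = c) -> l = c.
Proof.
move=> sl sc; apply: contrapT => /eqP lc.
have n0 : 0 < `|c - l| by rewrite normr_gt0 subr_eq0 eq_sym.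
have nE : `|c - l| = (complex.Re `|c - l|)%:C by rewrite RRe_real // ger0_real // ltW.
have [|M hM] := sl (complex.Re `|c - l|); first by move: n0; rewrite {1}nE ltcR.
have := hM (maxn M N) (leq_maxl _ _).
by rewrite sc ?leq_maxr // -nE ltxx.
Qed.

Lemma ccvg_diff (s : nat -> C) l (e : R) : ccvg s l -> 0 < e ->
  exists N, forall n, (N <= n)%N -> `|s n.+1 - s n| < e%:C.
Proof.
move=> sl e0; have [|N hN] := sl (e / 2); first by rewrite divr_gt0.
exists N => n Nn; have := hN n Nn; have := hN n.+1 (leqW Nn) => h1 h2.
rewrite -(subrKA l) -[l - _]opprB; apply: (le_lt_trans (ler_normB _ _)).
by rewrite [e]splitr rmorphD /= ltrD.
Qed.

Lemma borel0 : borel (fun _ : tend q => False).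
Proof. exact: borel_open. Qed.

(** For the constant sequence of empty sets the partial sums have all increments equal to the mass
    of the empty set, and these must tend to zero. *)
Lemma cmeasure0 mu : cmeasure mu -> mu (fun _ => False) = 0.
Proof.
move=> cm; have := cm (fun _ _ => False) (fun _ => borel0) (fun _ _ _ _ h => h.1).
rewrite (_ : (fun w => exists _, _) = (fun=> False)); last first.
  by apply/predeqP => w; split=> // -[].
move=> h; apply: contrapT => /eqP m0.
have n0 : 0 < `|mu (fun=> False)| by rewrite normr_gt0.
have nE : `|mu (fun=> False)| = (complex.Re `|mu (fun=> False)|)%:C.
  by rewrite RRe_real // ger0_real // ltW.
have [|M hM] := ccvg_diff h (e := complex.Re `|mu (fun=> False)|).
  by move: n0; rewrite {1}nE ltcR.
by have := hM M (leqnn _); rewrite big_ord_recr /= addrAC subrr add0r -nE ltxx.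
Qed.

Lemma cmeasure_add mu A B : cmeasure mu -> borel A -> borel B ->
  (forall w, ~ (A w /\ B w)) -> mu (fun w => A w \/ B w) = mu A + mu B.
Proof.
move=> cm bA bB dAB.
pose F n : tend q -> Prop := if n is n'.+1 then (if n' is _.+1 then fun _ => False else B) else A.
have bF n : borel (F n) by case: n => [|[|n]] //; exact: borel0.
have dF n m : n <> m -> forall w, ~ (F n w /\ F m w).
  case: n m => [|[|n]] [|[|m]] //= _ w [] // bw aw; exact: (dAB w).
have := cm F bF dF; rewrite (_ : (fun w => exists n, F n w) = (fun w => A w \/ B w)).
  move=> h; apply: (ccvg_cst_eq (N := 2) h) => -[|[|n]] // _.
  by rewrite 2!big_ord_recl /= big1 ?addr0 // => i _; exact: cmeasure0.
apply/predeqP => w; split=> [[[|[|n]]]|[]] //=; [by left|by right|by exists 0%N|by exists 1%N].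
Qed.

Lemma cmeasure_distribution mu : cmeasure mu -> distribution mu.
Proof. by move=> cm A B /alg_borel bA /alg_borel bB; exact: cmeasure_add. Qed.

Lemma extends_toP nu mu : distribution nu -> cmeasure mu ->
  (forall x, reduced x -> mu (arc x) = nu (arc x)) -> extends_to nu mu.
Proof.
move=> dn cm e; split=> // A; apply: distribution_eq_arc => //.
exact: cmeasure_distribution.
Qed.

Lemma cmeasure_lin mu mu' (c : C) : `|c| = 1 -> cmeasure mu -> cmeasure mu' ->
  cmeasure (fun A => mu A + c * mu' A).
Proof.
move=> c1 cm cm' An bA dA e e0.
have e2 : 0 < e / 2 by rewrite divr_gt0.
have [N hN] := cm An bA dA _ e2; have [N' hN'] := cm' An bA dA _ e2.
exists (maxn N N') => n; rewrite geq_max => /andP[/hN h /hN' h'].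
rewrite big_split /= -mulr_sumr opprD addrACA -mulrBr.
apply: (le_lt_trans (ler_normD _ _)); rewrite normrM c1 mul1r.
by rewrite [e]splitr rmorphD /= ltrD.
Qed.

(** Extending the weights by zero to words that are not reduced brings them into the form required
    by [word_measure]. *)
Lemma tree_measure (w0 : tend q) (p : word q -> R) :
  (forall x, reduced x -> 0 <= p x) ->
  (forall x, reduced x -> p x = \sum_(a | reduced (rcons x a)) p (rcons x a)) ->
  exists m : (tend q -> Prop) -> R,
    [/\ forall A, 0 <= m A, cmeasure (fun A => (m A)%:C) &
        forall x, reduced x -> m (arc x) = p x].
Proof.
move=> p0 padd; pose p' x := if reduced x then p x else 0.
have [x|x|x|m [m0 mp mS]] := @word_measure R q w0 p'.
- by rewrite /p'; case: ifP => // /p0.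
- rewrite /p'; case: ifP => [/padd ->|nr]; first by rewrite big_mkcond.
  by rewrite big1 // => a _; case: ifP => // /reduced_rconsW; rewrite nr.
- by rewrite /p' => /negPf ->.
exists m; split=> //; last by move=> x rx; rewrite mp // /p' rx.
move=> An bA dA e e0; have [N hN] := mS An bA dA e e0; exists N => n /hN.
by rewrite -rmorph_sum -rmorphB /= normc_def /= expr0n addr0 sqrtr_sqr ltcR.
Qed.

Lemma Re_le_norm (z : C) (r : R) : `|z| <= r%:C -> `|complex.Re z| <= r /\ `|complex.Im z| <= r.
Proof.
rewrite normc_def lecR => h; split; apply: le_trans h.
  by rewrite -sqrtr_sqr ler_sqrt ?lerDl ?sqr_ge0 // addr_ge0 ?sqr_ge0.
by rewrite -sqrtr_sqr ler_sqrt ?lerDr ?sqr_ge0 // addr_ge0 ?sqr_ge0.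
Qed.

(* Re nu + p, Im nu + p and p are nonnegative on arcs, so each of them comes
   from a positive measure. *)
Lemma dominated_extends_sigma (w0 : tend q) nu (p : word q -> R) : distribution nu ->
  (forall x, reduced x -> p x = \sum_(a | reduced (rcons x a)) p (rcons x a)) ->
  (forall x, reduced x -> `|nu (arc x)| <= (p x)%:C) -> extends_sigma nu.
Proof.
move=> dn padd nup.
have ReIm x (rx : reduced x) := Re_le_norm (nup x rx).
have [||m1 [_ c1 m1P]] := @tree_measure w0 (fun x => p x + complex.Re (nu (arc x))).
- by move=> x /ReIm[+ _]; rewrite ler_norml => /andP[h _]; lra.
- move=> x rx; rewrite padd // distribution_children //.
  by rewrite (raddf_sum (@complex.Re R : Rcomplex R -> R)) -big_split.
have [||m2 [_ c2 m2P]] := @tree_measure w0 (fun x => p x + complex.Im (nu (arc x))).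
- by move=> x /ReIm[_]; rewrite ler_norml => /andP[h _]; lra.
- move=> x rx; rewrite padd // distribution_children //.
  by rewrite (raddf_sum (@complex.Im R : Rcomplex R -> R)) -big_split.
have [||m0 [_ c0 m0P]] := @tree_measure w0 p.
- by move=> x /ReIm[+ _]; apply: le_trans.
- by [].
have cN : `|-1 : C| = 1 by rewrite normrN1.
have ci : `|'i : C| = 1 by rewrite normc_def /= expr0n expr1n add0r sqrtr1.
have := cmeasure_lin ci (cmeasure_lin cN c1 c0) (cmeasure_lin cN c2 c0).
set mu := (X in cmeasure X) => cm; exists mu; apply: extends_toP => // x rx.
rewrite /mu m1P // m2P // m0P //; case: (nu (arc x)) => u v /=.
by apply/eqP; rewrite eq_complex /=; apply/andP; split; apply/eqP; ring.
Qed.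

End ComplexMeasure.

(** * Additivity and bounds of the ray masses *)

Lemma card_reduced_rcons {q} (x : word q) : reduced x ->
  #|[pred a | reduced (rcons x a)]| = if x is [::] then q.+1 else q.
Proof.
case/lastP: x => [_|x b rx].
  by rewrite -[RHS]card_ord; apply: eq_card => a; rewrite !inE.
have -> : (if rcons x b is [::] then q.+1 else q) = #|predC1 b|.
  by rewrite cardC1 card_ord headI.
by apply: eq_card => a; rewrite !inE reduced_rcons rx eq_sym.
Qed.

Lemma ray_child {q} (xi : tend q) (x : word q) a :
  (pre xi (size (rcons x a)) == rcons x a) = (pre xi (size x) == x) && (a == xi (size x)).
Proof.
rewrite size_rcons preS; apply/eqP/andP => [/rcons_inj[-> ->]|[/eqP-> /eqP->]] //.
Qed.

Lemma ray_mass_pre {F : fieldType} {q} (xi : tend q) (w : F) n :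
  ray_mass xi w (pre xi n.+1) = w ^+ n.+1 * (1 - q%:R^-1).
Proof. by rewrite /ray_mass pre_size eqxx /pre. Qed.

(** Off the ray the q children share the mass equally. On the ray one child continues it and q - 1
    siblings, or q at the root, hold the rest; the separate root value in [ray_mass] accounts for
    the extra sibling. *)
Lemma ray_mass_children {F : fieldType} {q} (xi : tend q) (w : F) (x : word q) :
  q%:R != 0 :> F -> reduced x ->
  ray_mass xi w x = \sum_(a | reduced (rcons x a)) ray_mass xi w (rcons x a).
Proof.
move=> qF rx; have off a : ~~ (pre xi (size (rcons x a)) == rcons x a) ->
    ray_mass xi w (rcons x a) = (w * q%:R) ^+ size (conf x xi) / q%:R ^+ (size x).+1 * (1 - w).
  move=> h; rewrite /ray_mass (negPf h) size_rcons size_conf_rcons ifN //.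
  by move: h; rewrite size_rcons.
have [onx|offx] := boolP (pre xi (size x) == x); last first.
  rewrite (eq_bigr (fun _ => (w * q%:R) ^+ size (conf x xi) / q%:R ^+ (size x).+1 * (1 - w))).
    rewrite sumr_const card_reduced_rcons // /ray_mass (negPf offx).
    case: x offx {rx off} => // b x _; rewrite -[RHS]mulr_natl [_ ^+ (size (b :: x)).+1]exprS.
    have := expf_neq0 (size (b :: x)) qF; move: (q%:R ^+ size (b :: x)) => Q Q0.
    by field; rewrite qF Q0.
  by move=> a _; apply: off; rewrite ray_child (negPf offx).
have rxi : reduced (rcons x (xi (size x))).
  by rewrite -{1}(eqP onx) -preS reduced_pre.
rewrite (bigD1 (xi (size x))) //= (eq_bigr (fun _ => w ^+ size x / q%:R * (1 - w))); last first.
  move=> a /andP[_ ax]; rewrite off ?ray_child ?(negPf ax) ?andbF //.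
  move: onx; rewrite -conf_eq_size => /eqP ->; rewrite exprMn exprS.
  have := expf_neq0 (size x) qF; move: (q%:R ^+ size x) => Q Q0.
  by field; rewrite qF Q0.
have -> : rcons x (xi (size x)) = pre xi (size x).+1 by rewrite preS (eqP onx).
rewrite ray_mass_pre exprS.
rewrite sumr_const (_ : #|_| = if x is [::] then q else q.-1).
  rewrite /ray_mass onx -[X in _ = _ + X]mulr_natl; case: x {off onx rx rxi} => [|b x].
    by rewrite expr0; field.
  have q0 : (0 < q)%N by case: (q) qF => //; rewrite eqxx.
  by rewrite -[in q.-1%:R]subn1 natrB //; field.
have := cardD1 (xi (size x)) [pred a | reduced (rcons x a)].
rewrite card_reduced_rcons // inE rxi.
have -> : #|[predD1 [pred a | reduced (rcons x a)] & xi (size x)]| =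
  #|fun i : 'I_q.+1 => reduced (rcons x i) && (i != xi (size x))|.
  by apply: eq_card => a; rewrite !inE andbC.
by move: #|_| => m; case: x {onx rx rxi off} => [|b x] /=; lia.
Qed.

(** The constant compares |1 - w| <= 2 with 1 - |w| off the ray, and |1 - w/q| <= 2 with 1 - |w|/q
    >= 1 - |w| at the root. *)
Lemma norm_ray_mass_le {F : numFieldType} {q} (xi : tend q) (w : F) (x : word q) :
  (0 < q)%N -> `|w| < 1 ->
  `|ray_mass xi w x| <= 2 / (1 - `|w|) * ray_mass xi `|w| x.
Proof.
move=> q0 w1; have r0 := normr_ge0 w; have d0 : 0 < 1 - `|w| by rewrite subr_gt0.
have qge1 : 1 <= q%:R :> F by rewrite ler1n.
have qgt0 : 0 < q%:R :> F by rewrite ltr0n.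
have qV1 : q%:R^-1 <= 1 :> F by rewrite invf_le1.
have c1 : 1 <= 2 / (1 - `|w|).
  by rewrite ler_pdivlMr // mul1r lerBlDr (le_trans (ler1n _ 2)) // lerDl.
rewrite /ray_mass; case: eqP => _; last first.
  rewrite mulrCA mulfVK ?gt_eqF // normrM normf_div !normrX normrM (ger0_norm (ltW qgt0)).
  rewrite ler_wpM2l ?divr_ge0 ?exprn_ge0 ?mulr_ge0 ?(ltW qgt0) //.
  by rewrite (le_trans (ler_normB _ _)) // normr1 -[2]/(1 + 1) lerD2l ltW.
case: x => [|a x].
  apply: (@le_trans _ _ 2).
    rewrite (le_trans (ler_normB _ _)) // normr1 -[2]/(1 + 1) lerD2l normf_div.
    rewrite (ger0_norm (ltW qgt0)).
    by rewrite ler_pdivrMr // mul1r (le_trans (ltW w1)).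
  rewrite mulrAC ler_pdivlMr // ler_pM2l // lerD2l lerN2 ler_pdivrMr //.
  by rewrite ler_peMr.
rewrite normrM normrX (ger0_norm (_ : 0 <= 1 - q%:R^-1)) ?subr_ge0 //.
by rewrite ler_peMl // mulr_ge0 ?exprn_ge0 ?subr_ge0.
Qed.

Lemma ray_mass_gt0 {F : numFieldType} {q} (xi : tend q) (w : F) (x : word q) :
  (1 < q)%N -> 0 < w < 1 -> 0 < ray_mass xi w x.
Proof.
move=> q1 /andP[w0 w1]; have qgt0 : 0 < q%:R :> F by rewrite ltr0n ltnW.
have qV1 : q%:R^-1 < 1 :> F by rewrite invf_lt1 // ltr1n.
rewrite /ray_mass; case: eqP => _; last first.
  by rewrite mulr_gt0 ?subr_gt0 // divr_gt0 // exprn_gt0 // mulr_gt0.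
case: x => [|a x]; last by rewrite mulr_gt0 ?subr_gt0 // exprn_gt0.
by rewrite subr_gt0 ltr_pdivrMr // mul1r (lt_trans w1) // ltr1n.
Qed.

Lemma rmorph_ray_mass {F F' : fieldType} {q} (f : {rmorphism F -> F'})
    (xi : tend q) (w : F) (x : word q) :
  f (ray_mass xi w x) = ray_mass xi (f w) x.
Proof.
rewrite /ray_mass; case: ifP => _; last first.
  by rewrite rmorphM fmorph_div !rmorphXn rmorphM rmorphB rmorph1 rmorph_nat.
case: x => [|a x]; first by rewrite rmorphB fmorph_div rmorph1 rmorph_nat.
by rewrite rmorphM rmorphXn rmorphB fmorphV rmorph1 rmorph_nat.
Qed.

(** * Extension according to the modulus of the ratio *)

Section RayDistribution.
Context {R : realType} {q : nat} (xi : tend q).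
Local Notation C := R[i].
Variables (nu : (tend q -> Prop) -> C) (w : C).
Hypotheses (q1 : (1 < q)%N) (dn : distribution nu).
Hypothesis nuE : forall x, reduced x -> (1 - w / q%:R) * nu (arc x) = ray_mass xi w x.

Lemma ray_extends_sigma : `|w| < 1 -> extends_sigma nu.
Proof.
move=> w1; have qC : q%:R != 0 :> C by rewrite pnatr_eq0 -lt0n ltnW.
have qR : q%:R != 0 :> R by rewrite pnatr_eq0 -lt0n ltnW.
have rE : `|w| = (complex.Re `|w|)%:C by rewrite RRe_real // ger0_real.
have d0 : 1 - w / q%:R != 0.
  rewrite subr_eq0; apply/eqP => /(congr1 (fun z => `|z|)).
  rewrite normr1 normf_div normr_nat => e.
  have : `|w| / q%:R < 1.
    by rewrite ltr_pdivrMr ?ltr0n ?(ltnW q1) // mul1r (lt_trans w1) // ltr1n.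
  by rewrite -e ltxx.
have [d dE] : exists d : R, `|1 - w / q%:R| = d%:C.
  by exists (complex.Re `|1 - w / q%:R|); rewrite RRe_real // ger0_real.
have [r {}rE] : exists r : R, `|w| = r%:C by exists (complex.Re `|w|).
(* [K] joins the constant of [norm_ray_mass_le] with the division by the modulus of [1 - w / q]. *)
pose K := 2 / (1 - r) / d.
apply: (dominated_extends_sigma xi (p := fun x => K * ray_mass xi r x)) => //.
  by move=> x rx; rewrite -mulr_sumr -ray_mass_children.
move=> x rx.
have KE : K%:C = 2 / (1 - `|w|) / `|1 - w / q%:R|.
  by rewrite rE dE !rmorphM !fmorphV rmorphB rmorph1 rmorph_nat.
have mE : (ray_mass xi r x)%:C = ray_mass xi `|w| x.
  by rewrite rE (rmorph_ray_mass (real_complex R)).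
have -> : (K * ray_mass xi r x)%:C = K%:C * (ray_mass xi r x)%:C by rewrite rmorphM.
rewrite KE mE mulrAC ler_pdivlMr ?normr_gt0 //.
rewrite -normrM mulrC nuE //.
by apply: norm_ray_mass_le => //; exact: ltnW.
Qed.

(** The differences of consecutive arcs along the ray are disjoint, with masses proportional to w^n
    for n >= 1; sigma-additivity would force these to tend to zero. *)
Lemma ray_not_extends_sigma : 1 < `|w| -> ~ extends_sigma nu.
Proof.
move=> w1 [mu [cm muE]].
have q0 : 0 < q%:R :> C by rewrite ltr0n ltnW.
have qV1 : q%:R^-1 < 1 :> C by rewrite invf_lt1 // ltr1n.
pose A n := fun v : tend q => arc (pre xi n) v /\ ~ (exists y, y \in [:: pre xi n.+1] /\ arc y v).
have cA n : forall y, y \in [:: pre xi n.+1] -> is_child (pre xi n) y.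
  move=> y; rewrite inE => /eqP ->; split; first exact: reduced_pre.
  by exists (xi n); rewrite preS.
have bA n : basic (A n).
  by exists (pre xi n), [:: pre xi n.+1]; split; [exact: reduced_pre|split=> //; exact: cA].
have muA n : mu (A n) = nu (arc (pre xi n)) - nu (arc (pre xi n.+1)).
  rewrite muE; last exact: alg_basic.
  by rewrite (distribution_basic dn (reduced_pre xi n) (@cA n)) /= big_seq1.
have massA n : (1 - w / q%:R) * mu (A n.+1) = w ^+ n.+1 * ((1 - q%:R^-1) * (1 - w)).
  by rewrite muA mulrBr !nuE ?reduced_pre // !ray_mass_pre [w ^+ n.+2]exprS; ring.
have dA i j : i <> j -> forall v, ~ (A i v /\ A j v).
  wlog ij : i j / (i < j)%N.
    move=> wl ij v [iv jv]; have := ij => /eqP; rewrite neq_ltn => /orP[lt|lt].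
      exact: (wl i j lt ij v).
    by apply: (wl j i lt _ v) => // /esym.
  move=> _ v [[_ niv] [jv _]]; apply: niv; exists (pre xi i.+1); rewrite mem_head; split=> //.
  by move: jv; rewrite !arc_pre => jv; rewrite -(take_pre v ij) jv take_pre.
have := cm A (fun n => alg_borel (alg_basic (bA n))) dA.
move=> /ccvg_diff h.
pose del := `|(1 - q%:R^-1) * (1 - w)|.
have w_neq1 : 1 - w != 0.
  by rewrite subr_eq0; apply/eqP => e; move: w1; rewrite -e normr1 ltxx.
have del0 : 0 < del by rewrite normr_gt0 mulf_neq0 // subr_eq0 gt_eqF.
have wn n : 1 <= `|w| ^+ n by rewrite exprn_ege1 // ltW.
(* If 1 - w/q vanished, [massA] at 0 would give w (1 - 1/q) (1 - w) = 0, although all three factors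
   are nonzero. *)
have nz : 0 < `|1 - w / q%:R|.
  rewrite normr_gt0; apply/eqP => z; have := massA 0; rewrite z mul0r => /esym/eqP.
  rewrite mulf_eq0 -normr_eq0 normrX gt_eqF ?(lt_le_trans ltr01) //=.
  by rewrite -normr_eq0 gt_eqF.
have eE : (complex.Re (del / `|1 - w / q%:R|))%:C = del / `|1 - w / q%:R|.
  by rewrite RRe_real // ger0_real // divr_ge0 // ltW.
have [|N hN] := h (complex.Re (del / `|1 - w / q%:R|)).
  by rewrite -ltcR eE divr_gt0.
(* The index is [N.+1] because the root has its own ray mass, so that [massA] starts at level
   one. *)
have := hN N.+1 (leqnSn _); rewrite big_ord_recr /= addrAC subrr add0r eE ltr_pdivlMr //.
rewrite -normrM mulrC massA normrM normrX -/del gtr_pMl //.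
by move=> /(le_lt_trans (wn _)); rewrite ltxx.
Qed.

(** All arc masses are positive, so [tree_measure] applies directly; the support is full because a
    nonempty open set contains an arc. *)
Lemma ray_positive_measure : 0 < w < 1 ->
  exists mu, extends_to nu mu /\
    (forall A, borel A -> 0 <= mu A) /\
    mu (fun _ => True) = 1 /\
    (forall (U : tend q -> Prop) v, isopen U -> U v -> 0 < mu U).
Proof.
move=> w01; have [w0 w1] := andP w01.
have d0 : 0 < 1 - w / q%:R.
  by rewrite subr_gt0 ltr_pdivrMr ?ltr0n ?(ltnW q1) // mul1r (lt_trans w1) // ltr1n.
have nu_gt0 x : reduced x -> 0 < nu (arc x).
  by move=> rx; rewrite -(pmulr_rgt0 _ d0) nuE // ray_mass_gt0.
have nu_real x : reduced x -> nu (arc x) = (complex.Re (nu (arc x)))%:C.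
  by move=> rx; rewrite RRe_real // ger0_real // ltW // nu_gt0.
have [||m [m0 cm mP]] := @tree_measure R q xi (fun x => complex.Re (nu (arc x))).
- by move=> x rx; have := nu_gt0 x rx; rewrite {1}nu_real // ltcR => /ltW.
- move=> x rx; rewrite {1}distribution_children //.
  by rewrite (raddf_sum (@complex.Re R : Rcomplex R -> R)).
have mu_arc x : reduced x -> (m (arc x))%:C = nu (arc x).
  by move=> rx; rewrite mP // -nu_real.
exists (fun A => (m A)%:C); split; last split; last split.
- exact: extends_toP.
- by move=> A _; rewrite lecR.
- have -> : (fun=> True) = arc [::] :> (tend q -> Prop) by apply/predeqP => v; split.
  by rewrite mu_arc //; apply: (mulfI (lt0r_neq0 d0)); rewrite nuE // mulr1.
move=> U v oU Uv; have [n hn] := oU v Uv.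
have -> : U = (fun v' => arc (pre v n) v' \/ (U v' /\ ~ arc (pre v n) v')).
  apply/predeqP => v'; split=> [Uv'|[/arc_pre/hn //|[]//]].
  by have [?|?] := pselect (arc (pre v n) v'); [left|right].
rewrite (cmeasure_add cm) ?mu_arc ?reduced_pre //.
- by rewrite ltr_pwDl ?nu_gt0 ?reduced_pre // lecR.
- by apply: borel_open; exact: isopen_arc.
- apply: borel_open => v1 [Uv1 nv1]; have [k hk] := oU v1 Uv1; exists (maxn n k) => v2 v12.
  split.
    by apply: hk; rewrite -(take_pre v2 (leq_maxr n k)) v12 take_pre ?leq_maxr.
  move=> /arc_pre v2n; apply/nv1/arc_pre; rewrite -v2n.
  by rewrite -(take_pre v1 (leq_maxl n k)) -v12 take_pre ?leq_maxl.
- by move=> v' [? []].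
Qed.

End RayDistribution.

(** * Harmonic functions *)

Lemma parent_rcons {q} (x : word q) a : parent (rcons x a) = x.
Proof. by rewrite /parent size_rcons -cats1 take_size_cat. Qed.

Lemma sum_reduced_cst {V : nzRingType} {q} (x : word q) (v : V) : reduced x ->
  \sum_(a | reduced (rcons x a)) v = (if x is [::] then q.+1 else q)%:R * v.
Proof. by move=> rx; rewrite sumr_const card_reduced_rcons // mulr_natl. Qed.

Lemma sum_reduced_except {V : nzRingType} {q} (x : word q) (a0 : 'I_q.+1) (u v : V) :
  reduced (rcons x a0) ->
  \sum_(a | reduced (rcons x a)) (if a == a0 then u else v) =
  u + (if x is [::] then q.+1 else q)%:R * v - v.
Proof.
move=> r0; rewrite -sum_reduced_cst ?(reduced_rconsW r0) // (bigD1 a0) //= eqxx.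
rewrite [in RHS](bigD1 a0) //= [v + _]addrC -addrA addrK; congr (_ + _).
by apply: eq_bigr => a /andP[_ /negPf ->].
Qed.

Section Harmonic.
Context {R : realType} {q : nat} (varpi xi : tend q) (alpha : R).
Local Notation C := R[i].
Hypotheses (q1 : (1 < q)%N) (alpha01 : 0 < alpha < 1).
Let kap : C := (alpha / ((1 - alpha) * q%:R))%:C.
(** This is P conjugated by the factor kap^|x /\ varpi|, which removes the reference end. *)
Definition isotropic_op (G : word q -> C) (x : word q) : C :=
  (alpha / q%:R)%:C * \sum_(a | reduced (rcons x a)) G (rcons x a) +
  (if x is [::] then 0 else (1 - alpha)%:C * G (parent x)).

Let q0 : 0 < q%:R :> R. Proof. by rewrite ltr0n ltnW. Qed.

Let kapE : (1 - alpha)%:C * kap = (alpha / q%:R)%:C.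
Proof.
rewrite /kap -rmorphM; congr (_%:C).
have := gt_eqF q0; have [a0 a1] := andP alpha01.
have : 1 - alpha != 0 by rewrite subr_eq0 gt_eqF.
by move=> ? /negbT ?; field; apply/andP.
Qed.

Let alphaC0 : alpha%:C != 0.
Proof. by have [a0 _] := andP alpha01; rewrite (_ : 0 = 0%:C) // (inj_eq (@complexI R)) gt_eqF. Qed.

Let qC0 : q%:R != 0 :> C. Proof. by rewrite pnatr_eq0 -lt0n ltnW. Qed.

(** A step outwards along the ray to [varpi] has probability 1 - alpha and gains a factor [kap],
    with (1 - alpha) kap = alpha / q; the reverse step has probability alpha / q and loses that
    factor. *)
Lemma Pop_isotropic (G : word q -> C) (x : word q) :
  Pop varpi alpha (fun x => kap ^+ size (conf x varpi) * G x) x =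
  kap ^+ size (conf x varpi) * isotropic_op G x.
Proof.
have up a : ptrans varpi alpha x (rcons x a) * kap ^+ size (conf (rcons x a) varpi) =
    kap ^+ size (conf x varpi) * (alpha / q%:R)%:C.
  rewrite [ptrans _ _ _ _](edgew_up varpi (alpha / q%:R)%:C (1 - alpha)%:C).
  case: (size_conf_rcons_cases varpi x a) => [->|[-> _]]; first by rewrite eqxx mulrC.
  by rewrite ifN; [rewrite -kapE exprS; ring|lia].
rewrite /Pop /isotropic_op mulrDr; congr (_ + _).
  rewrite mulrA mulr_sumr; by apply: eq_bigr => a _; rewrite mulrA up.
case/lastP: x {up} => [|x a]; first by rewrite mulr0.
rewrite parent_rcons; set E := ptrans _ _ _ _ * _; set E' := _%:C * G x.
have -> : (if rcons x a is [::] then 0 else E) = E by rewrite headI.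
have -> : (if rcons x a is [::] then 0 else E') = E' by rewrite headI.
rewrite /E /E' [ptrans _ _ _ _](edgew_down varpi (alpha / q%:R)%:C (1 - alpha)%:C).
case: (size_conf_rcons_cases varpi x a) => [->|[-> _]]; first by rewrite eqxx; ring.
by rewrite ifN; [rewrite -kapE exprS; ring|lia].
Qed.

Lemma isotropic_op_lin (u v : C) G G' x :
  isotropic_op (fun x => u * G x + v * G' x) x = u * isotropic_op G x + v * isotropic_op G' x.
Proof.
rewrite /isotropic_op big_split /= -!mulr_sumr.
by case: x => [|b x]; ring.
Qed.

Lemma Ho_isotropic lam (G : word q -> C) : G [::] = 1 ->
  (forall x, reduced x -> 0 < G x) ->
  (forall x, reduced x -> isotropic_op G x = lam * G x) ->
  Ho varpi alpha lam (fun x => kap ^+ size (conf x varpi) * G x).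
Proof.
move=> G1 G0 GP; split=> [|x rx]; first by rewrite /conf /= expr0 mul1r.
split; last by rewrite Pop_isotropic GP //; ring.
have [a0 a1] := andP alpha01.
rewrite mulr_gt0 ?G0 // exprn_gt0 // /kap ltcR.
by rewrite divr_gt0 // mulr_gt0 // subr_gt0.
Qed.

Variables (m mt : C).
Hypothesis m_mt : alpha%:C * (m * mt) = (1 - alpha)%:C.

Lemma kap_m_mt : kap * m * mt * q%:R = 1.
Proof.
have [a0 a1] := andP alpha01.
have : kap * m * mt * q%:R * (1 - alpha)%:C = (1 - alpha)%:C.
  transitivity ((alpha / q%:R)%:C * (m * mt) * q%:R); first by rewrite -kapE; ring.
  by rewrite -m_mt rmorphM fmorphV rmorph_nat /=; field.
have : (1 - alpha)%:C != 0 by rewrite (_ : 0 = 0%:C) // (inj_eq (@complexI R)) subr_eq0 gt_eqF.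
by move=> nz /(canRL (mulfK nz)) ->; rewrite divff.
Qed.

Hypotheses (m0 : 0 < m) (mmt : m < mt).

Let mt0 : 0 < mt. Proof. exact: lt_trans mmt. Qed.

(** [m] and [mt] are the roots of alpha z^2 - lam z + (1 - alpha) = 0, so their powers solve the
    radial equation at every vertex but the root. *)
Let lam := alpha%:C * (m + mt).

(** The tilde kernel at [xi] without its [kap] factor, since kap mt^2 = mt / (q m). *)
Definition ray_potential (x : word q) : C :=
  mt ^+ size x * (q%:R * m / mt) ^+ size (conf x xi).

Let mt_neq0 : mt != 0. Proof. exact: lt0r_neq0. Qed.

Let aq : (alpha / q%:R)%:C = alpha%:C / q%:R.
Proof. by rewrite rmorphM fmorphV rmorph_nat. Qed.

Let d0 : mt - m != 0. Proof. by rewrite subr_eq0 gt_eqF. Qed.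

(** Off the ray the powers of [mt] solve the radial equation. On the ray the values are (q m)^n: the
    q - 1 siblings give alpha mt (q - 1) / q, and the parent supplies the missing alpha mt / q. *)
Lemma ray_potential_harmonic x : reduced x ->
  isotropic_op ray_potential x = lam * ray_potential x.
Proof.
move=> rx; rewrite /isotropic_op aq.
have [onx|offx] := boolP (pre xi (size x) == x).
  have rxi : reduced (rcons x (xi (size x))) by rewrite -{1}(eqP onx) -preS reduced_pre.
  rewrite (eq_bigr (fun a => if a == xi (size x) then
      mt ^+ (size x).+1 * (q%:R * m / mt) ^+ (size x).+1 else
      mt ^+ (size x).+1 * (q%:R * m / mt) ^+ size x)); last first.
    move=> a _; rewrite /ray_potential size_rcons size_conf_rcons
      -[X in pre xi X](size_rcons x a) ray_child onx /=.
    by case: ifP => // _; move: onx; rewrite -conf_eq_size => /eqP ->.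
  rewrite sum_reduced_except //.
  rewrite /ray_potential; have /eqP -> : size (conf x xi) == size x by rewrite conf_eq_size.
  case/lastP: x rx onx rxi => [_ _ _|x b rx onx rxi].
    rewrite /= !expr1 !expr0 -[q.+1%:R]natr1 /lam; field.
    by rewrite ?mt_neq0 ?qC0 ?d0.
  have onx' : pre xi (size x) == x by move: onx; rewrite ray_child => /andP[].
  have -> : (if rcons x b is [::] then q.+1 else q) = q by rewrite headI.
  have -> : forall E : C, (if rcons x b is [::] then 0 else E) = E by move=> E; rewrite headI.
  rewrite parent_rcons; have /eqP -> : size (conf x xi) == size x by rewrite conf_eq_size.
  rewrite -m_mt size_rcons !exprS /lam.
  move: (mt ^+ _) ((q%:R * m / mt) ^+ _) => M L; field.
  by rewrite ?mt_neq0 ?qC0 ?d0.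
rewrite (eq_bigr (fun a => mt ^+ (size x).+1 * (q%:R * m / mt) ^+ size (conf x xi))); last first.
  move=> a _; rewrite /ray_potential size_rcons size_conf_rcons
      -[X in pre xi X](size_rcons x a) ray_child.
  by rewrite (negPf offx).
rewrite sum_reduced_cst // /ray_potential.
case/lastP: x rx offx => [_ |x b rx offx]; first by rewrite eqxx.
have -> : (if rcons x b is [::] then q.+1 else q) = q by rewrite headI.
have -> : forall E : C, (if rcons x b is [::] then 0 else E) = E by move=> E; rewrite headI.
have -> : size (conf (rcons x b) xi) = size (conf x xi).
  by rewrite size_conf_rcons -[X in pre xi X](size_rcons x b) (negPf offx).
rewrite parent_rcons -m_mt size_rcons !exprS /lam.
by move: (mt ^+ _) ((q%:R * m / mt) ^+ _) => M L; field; rewrite ?mt_neq0 ?qC0 ?d0.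
Qed.

(** Each step along the ray contributes q m and each later step mt, both at least m. *)
Lemma ray_potential_ge x : m ^+ size x <= ray_potential x.
Proof.
have cx := size_conf_le xi x; rewrite /ray_potential; set c := size _ in cx *.
rewrite -{1 2}(subnK cx) !exprD -mulrA -exprMn.
apply: ler_pM; rewrite ?exprn_ge0 ?(ltW m0) //.
  by apply: lerXn2r; rewrite ?nnegrE ltW //.
rewrite mulrC divfK //; apply: lerXn2r; rewrite ?nnegrE ?mulr_ge0 ?ler0n ?ltW //.
by rewrite ltr_pMl ?ltr1n.
Qed.

Lemma ray_potential_gt0 x : 0 < ray_potential x.
Proof. by apply: lt_le_trans (ray_potential_ge x); rewrite exprn_gt0. Qed.

(* The weight [branch_coef] is what makes [branch_potential] harmonic at the root. *)
Definition branch_coef : C := (q%:R * mt - m) / (mt - m).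

Definition branch_potential (a : 'I_q.+1) (x : word q) : C :=
  m ^+ size x + (if ohead x == Some a then branch_coef * (mt ^+ size x - m ^+ size x) else 0).

Lemma branch_potential_harmonic a x : reduced x ->
  isotropic_op (branch_potential a) x = lam * branch_potential a x.
Proof.
move=> rx; rewrite /isotropic_op aq; case/lastP: x rx => [_|x b rx].
  rewrite (eq_bigr (fun b => if b == a then m + branch_coef * (mt - m) else m)); last first.
    move=> b _; rewrite /branch_potential /= !expr1 -[_ == Some a]/(b == a).
    by case: ifP => // _; rewrite addr0.
  rewrite (@sum_reduced_except _ _ [::] a) // -[q.+1%:R]natr1.
  by rewrite /branch_potential /branch_coef /= expr0 /lam; field; rewrite ?mt_neq0 ?qC0 ?d0.
have ohE c : ohead (rcons (rcons x b) c) = ohead (rcons x b) by case: (x).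
rewrite (eq_bigr (fun c => m ^+ (size x).+2 + (if ohead (rcons x b) == Some a then
    branch_coef * (mt ^+ (size x).+2 - m ^+ (size x).+2) else 0))); last first.
  by move=> c _; rewrite /branch_potential ohE !size_rcons.
rewrite sum_reduced_cst //.
have -> : (if rcons x b is [::] then q.+1 else q) = q by rewrite headI.
have -> : forall E : C, (if rcons x b is [::] then 0 else E) = E by move=> E; rewrite headI.
(* The parent may be the root, where the correction mt^0 - m^0 vanishes; one formula thus covers
   both cases. *)
have parE : branch_potential a x = m ^+ size x + (if ohead (rcons x b) == Some a then
    branch_coef * (mt ^+ size x - m ^+ size x) else 0).
  by case: x {rx ohE} => [|c x] //; rewrite /branch_potential /= subrr mulr0 if_same.
rewrite parent_rcons parE /branch_potential -m_mt size_rcons !exprS /lam.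
by case: ifP => _; field; rewrite ?mt_neq0 ?qC0 ?d0.
Qed.

Lemma branch_coef_ge1 : 1 <= branch_coef.
Proof.
rewrite ler_pdivlMr ?subr_gt0 // mul1r lerD2r ler_peMl ?ltW // ltr1n.
exact: q1.
Qed.

Lemma branch_potential_gt0 a x : 0 < branch_potential a x.
Proof.
rewrite /branch_potential ltr_pwDl ?exprn_gt0 //; case: ifP => // _.
rewrite mulr_ge0 ?(le_trans ler01 branch_coef_ge1) // subr_ge0.
by apply: lerXn2r; rewrite ?nnegrE ltW //.
Qed.

(** On the branch at [a] the confluent with [xi] is the root, so the ray potential there is mt^|x|;
    elsewhere [ray_potential_ge] suffices. *)
Lemma branch_potential_le a x : a != xi 0%N ->
  branch_potential a x <= branch_coef * ray_potential x.
Proof.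
move=> axi; rewrite /branch_potential; case: eqP => [xa|_].
  have -> : ray_potential x = mt ^+ size x.
    rewrite /ray_potential; case: x xa => // b x [->]; rewrite /conf /= /pre /=.
    by rewrite (negPf axi) expr0 mulr1.
  rewrite mulrBr addrCA gerDl subr_le0 ler_peMl ?exprn_ge0 ?(ltW m0) //.
  exact: branch_coef_ge1.
rewrite addr0 (le_trans (ray_potential_ge x)) // ler_peMl ?branch_coef_ge1 // ltW //.
exact: ray_potential_gt0.
Qed.

Lemma ray_potential_not_minimal :
  ~ minimal varpi alpha lam (fun x => kap ^+ size (conf x varpi) * ray_potential x).
Proof.
move=> [_ extr].
have [a axi] : exists a : 'I_q.+1, a != xi 0%N.
  have [->|] := eqVneq (xi 0%N) ord0; last by exists ord0; rewrite eq_sym.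
  by exists (lift ord0 (Ordinal (ltnW q1))).
have A1 := branch_coef_ge1; have A0 := lt_le_trans ltr01 A1.
have A2 : 1 < 2 * branch_coef.
  have h2 : 1 < 2 :> C by rewrite ltr1n.
  by apply: lt_le_trans h2 _; rewrite ler_peMr.
have A2gt0 := lt_trans ltr01 A2.
(* With this [t], t times the branch potential is at most half of the ray potential, so the
   complementary function [G1] stays positive. *)
pose t : R := complex.Re (2 * branch_coef)^-1.
have tE : t%:C = (2 * branch_coef)^-1.
  by rewrite /t RRe_real // ger0_real // invr_ge0 ltW.
have t0 : 0 < t by rewrite -ltcR tE invr_gt0.
have t1' : t%:C < 1 by rewrite tE invf_lt1.
have t1 : t < 1 by rewrite -ltcR.
have t1C : 1 - t%:C != 0 by rewrite subr_eq0 gt_eqF.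
pose G1 x := (1 - t%:C)^-1 * ray_potential x + (- t%:C / (1 - t%:C)) * branch_potential a x.
have root1 : ray_potential [::] = 1 by rewrite /ray_potential /conf /= !expr0 mulr1.
have root2 : branch_potential a [::] = 1 by rewrite /branch_potential /= expr0 addr0.
have H2 : Ho varpi alpha lam (fun x => kap ^+ size (conf x varpi) * branch_potential a x).
  apply: Ho_isotropic => // x rx; [exact: branch_potential_gt0|exact: branch_potential_harmonic].
have H1 : Ho varpi alpha lam (fun x => kap ^+ size (conf x varpi) * G1 x).
  apply: Ho_isotropic => [|x _|x rx].
  - by rewrite /G1 root1 root2; field.
  - have -> : G1 x = (1 - t%:C)^-1 * (ray_potential x - t%:C * branch_potential a x).
      by rewrite /G1; field.
    rewrite mulr_gt0 //.
      by rewrite invr_gt0 subr_gt0.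
    rewrite subr_gt0 tE mulrC ltr_pdivrMr //.
    apply: le_lt_trans (branch_potential_le x axi) _.
    rewrite mulrC ltr_pM2l ?ray_potential_gt0 // -[ltLHS]mul1r ltr_pM2r //.
    by rewrite ltr1n.
  - rewrite [LHS](isotropic_op_lin (1 - t%:C)^-1 (- t%:C / (1 - t%:C)) ray_potential
      (branch_potential a)).
    by rewrite /G1 ray_potential_harmonic // branch_potential_harmonic //; ring.
have kap0 : kap != 0.
  by apply/eqP => k0; have /eqP := kap_m_mt; rewrite k0 !mul0r eq_sym oner_eq0.
have t01 : 0 < t < 1 by rewrite t0.
have eqH x : reduced x -> kap ^+ size (conf x varpi) * ray_potential x =
    t%:C * (kap ^+ size (conf x varpi) * branch_potential a x) +
    (1 - t)%:C * (kap ^+ size (conf x varpi) * G1 x).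
  by move=> _; rewrite rmorphB rmorph1 /G1; field.
(* At the first vertex of the ray to [xi] the branch potential is m and the ray potential q m;
   equality of the two components would give m = q m. *)
have := extr _ _ t H2 H1 t01 eqH [:: xi 0%N] isT.
move=> /(mulfI (expf_neq0 _ kap0)).
rewrite /G1.
have -> : branch_potential a [:: xi 0%N] = m.
  by rewrite /branch_potential /= -[_ == Some a]/(xi 0%N == a) eq_sym (negPf axi) addr0.
have -> : ray_potential [:: xi 0%N] = q%:R * m.
  by rewrite /ray_potential /conf /= /pre /= eqxx /= !expr1; field.
move=> /(congr1 (fun z => z * (1 - t%:C))).
have -> : ((1 - t%:C)^-1 * (q%:R * m) + - t%:C / (1 - t%:C) * m) * (1 - t%:C) =
    q%:R * m - t%:C * m.
  by field.
rewrite mulrBr mulr1 [m * _]mulrC => /addIr /eqP.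
by rewrite -{1}[m]mul1r (inj_eq (mulIf (lt0r_neq0 m0))) eq_sym gt_eqF // ltr1n.
Qed.

End Harmonic.

(** * The two roots for a parameter off the interval *)

Section Roots.
Context {R : realType} (alpha : R) (lam : R[i]).
Local Notation C := R[i].
Hypothesis alpha01 : 0 < alpha < 1.
Let rho := 2%:R * Num.sqrt (alpha * (1 - alpha)).
Hypothesis lam_off : ~ (complex.Im lam = 0 /\ - rho <= complex.Re lam <= rho).

Let rho_ge0 : 0 <= rho. Proof. by rewrite mulr_ge0 // sqrtr_ge0. Qed.

Let rho2 : rho ^+ 2 = 4%:R * (alpha * (1 - alpha)).
Proof.
have [a0 a1] := andP alpha01.
by rewrite exprMn sqr_sqrtr; [ring|apply: mulr_ge0; lra].
Qed.

Lemma lam_neq0 : lam != 0.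
Proof.
by apply/eqP => l0; apply: lam_off; rewrite l0 /=; split=> //; rewrite oppr_le0 rho_ge0.
Qed.

Let s : C := sqrtc (1 - 4%:R * (alpha * (1 - alpha))%:C / lam ^+ 2).

Let s2 : lam ^+ 2 * (1 - s ^+ 2) = (rho ^+ 2)%:C.
Proof.
rewrite /s sqr_sqrtc rho2 [RHS]rmorphM rmorph_nat.
by field; exact: lam_neq0.
Qed.

Lemma Re_sqrtc_ge0 (z : C) : 0 <= complex.Re (sqrtc z).
Proof. by case: z => a b; rewrite /sqrtc /= sqrtr_ge0. Qed.

(** If s = i v, then lam^2 (1 + v^2) = rho^2, which makes lam real with |lam| <= rho, contrary to
    [lam_off]. *)
Lemma Re_s_gt0 : 0 < complex.Re s.
Proof.
rewrite lt_neqAle Re_sqrtc_ge0 andbT; apply/eqP => s0.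
move: s2 lam_off; case: s s0 => u v /= <-; case: lam => x y /=.
rewrite !expr2; simpc => -[e1 e2] off; apply: off.
have v1 : 0 < 1 + v * v by rewrite ltr_pwDl ?ltr01 // -expr2 sqr_ge0.
have xy : x * y = 0.
  have : (x * y) * (2 * (1 + v * v)) = 0 by rewrite -e2; ring.
  move/eqP; rewrite mulf_eq0 [_ * _ == 0 in X in _ || X]mulf_eq0 pnatr_eq0.
  by rewrite (gt_eqF v1) !orbF => /eqP.
have y0 : y = 0.
  have [x0|//] : x = 0 \/ y = 0 by move/eqP: xy; rewrite mulf_eq0 => /orP[] /eqP; tauto.
  have : y * y * (1 + v * v) + rho * rho = 0 by rewrite -e1 x0; ring.
  have yy : 0 <= y * y by rewrite -expr2 sqr_ge0.
  move/eqP; rewrite paddr_eq0 ?(mulr_ge0 yy (ltW v1)) ?(mulr_ge0 rho_ge0 rho_ge0) //.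
  by rewrite mulf_eq0 (gt_eqF v1) orbF mulf_eq0 orbb => /andP[/eqP].
have vv : 0 <= v * v by rewrite -expr2 sqr_ge0.
have xr : x * x <= rho * rho.
  by rewrite -e1 y0 mulr0 subr0 ler_peMr ?lerDl // -expr2 sqr_ge0.
by split=> //; rewrite -ler_norml -ler_sqr ?nnegrE // real_normK ?num_real // !expr2.
Qed.

Let am_ap : alpha%:C != 0 /\ 2%:R * alpha%:C != 0 :> C.
Proof.
have [a0 _] := andP alpha01.
have a0' : alpha%:C != 0 by rewrite (_ : 0 = 0%:C) // (inj_eq (@complexI R)) gt_eqF.
by split=> //; rewrite mulf_neq0 // pnatr_eq0.
Qed.

Lemma Fm_add_Fmt : alpha%:C * (Fm alpha lam + Fmt alpha lam) = lam.
Proof. by have [a0 _] := am_ap; rewrite /Fm /Fmt; field. Qed.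

Lemma Fm_mul_Fmt : alpha%:C * (Fm alpha lam * Fmt alpha lam) = (1 - alpha)%:C.
Proof.
have [a0 _] := am_ap; rewrite /Fm /Fmt -/s.
transitivity (lam ^+ 2 * (1 - s ^+ 2) / (4%:R * alpha%:C)); first by field.
by rewrite s2 rho2 !rmorphM rmorph_nat; field.
Qed.

Lemma Fm_Fmt_neq0 : Fm alpha lam != 0 /\ Fmt alpha lam != 0.
Proof.
have [_ a1] := andP alpha01.
have : Fm alpha lam * Fmt alpha lam != 0.
  apply/eqP => z; have := Fm_mul_Fmt; rewrite z mulr0 => /esym/eqP.
  by rewrite (_ : 0 = 0%:C) // (inj_eq (@complexI R)) subr_eq0 gt_eqF.
by rewrite mulf_eq0 negb_or => /andP.
Qed.

(** After cancelling the common factor this is |1 - s| < |1 + s|, equivalent to Re s > 0. *)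
Lemma norm_Fm_lt : `|Fm alpha lam| < `|Fmt alpha lam|.
Proof.
have [_ a2] := am_ap.
rewrite /Fm /Fmt -/s !normrM ltr_pM2l; last by rewrite mulr_gt0 // normr_gt0 ?invr_eq0 ?lam_neq0.
have := Re_s_gt0; case: s => u v /= u0; rewrite !normc_def /= ltcR ltr_sqrt; last first.
  by rewrite ltr_pwDl ?sqr_ge0 // exprn_gt0 // ltr_wpDl.
by rewrite !expr2; nra.
Qed.

(** Here s^2 = 1 - rho^2 / lam^2 lies strictly between 0 and 1, and the principal branch gives 0 < s
    < 1. *)
Lemma Fm_Fmt_real : complex.Im lam = 0 -> rho < complex.Re lam ->
  0 < Fm alpha lam < Fmt alpha lam.
Proof.
move=> im0 rlam; have [a0 a1] := andP alpha01.
have lam0 : 0 < lam by rewrite ltcE im0 eqxx /=; exact: le_lt_trans rlam.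
have lr : lam = (complex.Re lam)%:C by rewrite RRe_real // ger0_real // ltW.
have s2E : s ^+ 2 = 1 - (rho ^+ 2)%:C / lam ^+ 2.
  by rewrite -s2; field; exact: lam_neq0.
have rho_gt0 : 0 < rho ^+ 2 by rewrite rho2 mulr_gt0 // mulr_gt0 // subr_gt0.
have s2lt : 0 < s ^+ 2 < 1.
  rewrite s2E subr_gt0 ltr_pdivrMr ?exprn_gt0 // mul1r.
  rewrite gtrDl oppr_lt0 divr_gt0 ?exprn_gt0 ?ltcR // andbT.
  by rewrite lr -rmorphXn ltcR !expr2; have := rho_ge0; nra.
have s0 : 0 < s.
  rewrite lt_neqAle eq_sym; apply/andP; split.
    by apply/eqP => z; move: s2lt; rewrite z expr0n ltxx.
  by rewrite /s sqrtc_ge0; move: s2lt; rewrite /s sqr_sqrtc => /andP[/ltW].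
have s1 : s < 1 by move: s2lt => /andP[_]; rewrite expr_lt1 // ltW.
have c0 : 0 < lam / (2%:R * alpha%:C).
  by rewrite divr_gt0 // mulr_gt0 ?ltcR // ltr0n.
rewrite /Fm /Fmt -/s mulr_gt0 ?subr_gt0 //= ltr_pM2l // ltrD2l.
by apply: (lt_trans _ s0); rewrite oppr_lt0.
Qed.

End Roots.

(** * Extension, non-extension and non-minimality *)

Unset Implicit Arguments.

Theorem theorem4p5 (R : realType) (q : nat) (varpi : tend q) (alpha : R)
  (lam : R[i]) (xi : tend q) :
  (2 <= q)%N -> 0 < alpha < 1 ->
  let rho := 2%:R * Num.sqrt (alpha * (1 - alpha)) in
  let lam0 := (q.+1%:R / (2%:R * Num.sqrt q%:R)) * rho in
  ~ (complex.Im lam = 0 /\ - rho <= complex.Re lam <= rho) ->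
  lam <> lam0%:C ->
  (forall nu : (tend q -> Prop) -> R[i], distribution nu ->
     (forall x, reduced x -> dint nu (K varpi alpha lam x) (Kt varpi alpha lam x xi)) ->
     extends_sigma nu)
  /\
  (forall nut : (tend q -> Prop) -> R[i], distribution nut ->
     (forall x, reduced x -> dint nut (Kt varpi alpha lam x) (K varpi alpha lam x xi)) ->
     ~ extends_sigma nut)
  /\
  ((complex.Im lam = 0 /\ rho < complex.Re lam) ->
     (forall nu : (tend q -> Prop) -> R[i], distribution nu ->
        (forall x, reduced x -> dint nu (K varpi alpha lam x) (Kt varpi alpha lam x xi)) ->
        exists mu, extends_to nu mu /\
          (forall A, borel A -> 0 <= mu A) /\
          mu (fun _ => True) = 1 /\
          (forall (U : tend q -> Prop) w, isopen U -> U w -> 0 < mu U))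
     /\
     (Ho varpi alpha lam (fun x => Kt varpi alpha lam x xi) /\
      ~ minimal varpi alpha lam (fun x => Kt varpi alpha lam x xi))).
Proof.
move=> q1 alpha01 rho lam0 lam_off _.
have q0 := ltnW q1; have [m0 mt0] := Fm_Fmt_neq0 alpha01 lam_off.
pose kap : R[i] := (alpha / ((1 - alpha) * q%:R))%:C.
have mmt := Fm_mul_Fmt alpha01 lam_off.
have kmm : kap * Fm alpha lam * Fmt alpha lam * q%:R = 1 := kap_m_mt q1 alpha01 mmt.
have kmm' : kap * Fmt alpha lam * Fm alpha lam * q%:R = 1 by rewrite -[RHS]kmm; ring.
have kap0 : kap != 0 by apply/eqP => z; have /eqP := kmm; rewrite z !mul0r eq_sym oner_eq0.
have norm_lt := norm_Fm_lt alpha01 lam_off.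
split; last split.
- move=> nu dn nuP; apply: (ray_extends_sigma q1 dn (arc_mass q0 kap0 m0 mt0 dn nuP kmm)).
  by rewrite normf_div ltr_pdivrMr ?normr_gt0 // mul1r.
(* Exchanging the kernels exchanges the two roots and so inverts the ratio. *)
- move=> nut dn nutP; apply: (ray_not_extends_sigma q1 dn (arc_mass q0 kap0 mt0 m0 dn nutP kmm')).
  by rewrite normf_div ltr_pdivlMr ?normr_gt0 // mul1r.
move=> [im_lam rho_lt]; have /andP[m_gt0 m_lt] := Fm_Fmt_real alpha01 lam_off im_lam rho_lt.
split.
  move=> nu dn nuP; apply: (ray_positive_measure q1 dn (arc_mass q0 kap0 m0 mt0 dn nuP kmm)).
  have mt_gt0 := lt_trans m_gt0 m_lt.
  by rewrite divr_gt0 //= ltr_pdivrMr // mul1r.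
have KtE : (fun x => Kt varpi alpha lam x xi) = (fun x => kap ^+ size (conf x varpi) *
    ray_potential xi (Fm alpha lam) (Fmt alpha lam) x).
  apply/funext => x; rewrite /Kt [LHS](KfE varpi x xi kap0 mt0) /ray_potential.
  have -> : q%:R * Fm alpha lam / Fmt alpha lam = (kap * Fmt alpha lam ^+ 2)^-1.
    have nz : kap * Fmt alpha lam ^+ 2 != 0 by rewrite mulf_neq0 // expf_neq0.
    apply: (mulIf nz); rewrite mulVf // -[RHS]kmm.
    by move: (kap) => k; field.
  by rewrite exprVn; ring.
have lamE := Fm_add_Fmt lam alpha01.
rewrite KtE; split; last first.
  rewrite -{1}lamE.
  exact: (ray_potential_not_minimal q1 alpha01 mmt m_gt0 m_lt).
apply: (Ho_isotropic varpi q1 alpha01) => [|x _|x rx].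
- by rewrite /ray_potential /conf /= !expr0 mulr1.
- exact: (ray_potential_gt0 xi q1 m_gt0 m_lt).
- by rewrite (ray_potential_harmonic xi q1 mmt m_gt0 m_lt) // lamE.
Qed.
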